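(* For all positive integers $j, k, n, r$, $$\operatorname{NCN}_{j,k}(n,r) = \operatorname{NCN}_{k,j}(n,r) \quad\text{and}\quad \operatorname{NC}_k(n,r) = \operatorname{NN}_k(n,r),$$ where $\operatorname{NCN}_{j,k}(n,r)$ is the number of $r$-coloured permutations $\Sigma$ of $[n]$ with $\operatorname{cr}(\Sigma)<j$ and $\operatorname{ne}(\Sigma)<k$, $\operatorname{NC}_k(n,r)$ is the number of those with $\operatorname{cr}(\Sigma)<k$, and $\operatorname{NN}_k(n,r)$ is the number of those with $\operatorname{ne}(\Sigma)<k$.
   Context: Write $[n]=\{1,\dots,n\}$. A permutation $S$ of $[n]$ is a bijection $\sigma:[n]\to[n]$. Arc diagram: $S$ is drawn on vertices $1,\dots,n$ placed in order on a horizontal line, with exactly one arc for each $i\in[n]$, joining $i$ and $\sigma(i)$. The arc is an upper arc if $\sigma(i)\ge i$ (so a fixed point gives an upper loop) and a lower arc if $\sigma(i)<i$. Record each arc as a pair (left endpoint, right endpoint): an upper arc is the pair $(i,\sigma(i))$ with $i\le\sigma(i)$, and a lower arc is the pair $(\sigma(i),i)$ with $\sigma(i)<i$. Let $\operatorname{Arc}(S)$ be the set of all $n$ arcs (upper and lower arcs are regarded as distinct even if they have the same endpoints). $r$-coloured permutation: a pair $\Sigma=(S,\phi)$, where $S$ is a permutation of $[n]$ and $\phi:\operatorname{Arc}(S)\to[r]$ is an arbitrary map (arc colouring). Crossings and nestings: a set of $k$ arcs $(i_1,j_1),\dots,(i_k,j_k)$ is - a $k$-crossing if $i_1<i_2<\dots<i_k<j_1<j_2<\dots<j_k$;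 - a $k$-nesting if $i_1<i_2<\dots<i_k<j_k<j_{k-1}<\dots<j_1$; - an enhanced $k$-crossing if $i_1<i_2<\dots<i_k\le j_1<j_2<\dots<j_k$; - an enhanced $k$-nesting if $i_1<i_2<\dots<i_k\le j_k<j_{k-1}<\dots<j_1$. For permutations, the enhanced notions are used for upper arcs and the non-enhanced notions for lower arcs. Thus $\Sigma$ is said to have a $k$-crossing (resp. $k$-nesting) if there are $k$ upper arcs all of the same colour forming an enhanced $k$-crossing (resp. enhanced $k$-nesting), or $k$ lower arcs all of the same colour forming a $k$-crossing (resp. $k$-nesting). Define $\operatorname{cr}(\Sigma)$ (resp. $\operatorname{ne}(\Sigma)$) as the maximum integer $k$ such that $\Sigma$ has a $k$-crossing (resp. $k$-nesting). $\Sigma$ is $k$-noncrossing if $\operatorname{cr}(\Sigma)<k$ and $k$-nonnesting if $\operatorname{ne}(\Sigma)<k$. *)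

(* Defs.v *)
From mathcomp Require Import all_boot all_fingroup.

Set Implicit Arguments.
Unset Strict Implicit.
Unset Printing Implicit Defensive.

(** The vertices [1, ..., n] of the arc diagram are the elements
    [0, ..., n - 1] of ['I_n]. *)

(** [(u, i, j)]: left endpoint [i], right endpoint [j], upper iff [u]. The
    flag keeps an upper and a lower arc with the same endpoints distinct. *)
Definition arc (n : nat) : finType := (bool * 'I_n * 'I_n)%type.

Definition upper n (a : arc n) : bool := a.1.1.
Definition left n (a : arc n) : nat := a.1.2.
Definition right n (a : arc n) : nat := a.2.

Definition arc_from n (S : {perm 'I_n}) (i : 'I_n) : arc n :=
  if i <= S i then (true, i, S i) else (false, S i, i).

Definition Arc n (S : {perm 'I_n}) : {set arc n} :=
  [set arc_from S i | i : 'I_n].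

Definition coloured_perm (n r : nat) : finType :=
  {S : {perm 'I_n} & {ffun {a : arc n | a \in Arc S} -> 'I_r}}.

(** A set of [k] arcs is listed as a sequence of length [k] in increasing
    order of left endpoints, so [s] stands for
    [(i_1, j_1), ..., (i_k, j_k)]. *)
Section Patterns.
Variables (n : nat) (s : seq (arc n)).

Let I := [seq left a | a <- s].
Let J := [seq right a | a <- s].

(** [i_1 < ... < i_k < j_1 < ... < j_k] *)
Definition crossing : bool := sorted ltn (I ++ J).

(** [i_1 < ... < i_k < j_k < ... < j_1] *)
Definition nesting : bool := sorted ltn (I ++ rev J).

(** [i_1 < ... < i_k <= j_1 < ... < j_k] *)
Definition enh_crossing : bool :=
  [&& sorted ltn I, sorted ltn J & last 0 I <= head 0 J].

(** [i_1 < ... < i_k <= j_k < ... < j_1] *)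
Definition enh_nesting : bool :=
  [&& sorted ltn I, sorted ltn (rev J) & last 0 I <= head 0 (rev J)].

End Patterns.

(** Some [k] arcs of [Sigma], all upper (if [u]) or all lower (if [~~ u]) and
    all of the same colour, satisfy [P]. *)
Definition has_mono n r (Sigma : coloured_perm n r) (u : bool)
    (P : seq (arc n) -> bool) (k : nat) : bool :=
  [exists c : 'I_r,
   exists t : k.-tuple {a : arc n | a \in Arc (tag Sigma)},
     [&& all (fun a => upper (val a) == u) t,
         all (fun a => tagged Sigma a == c) t
       & P [seq val a | a <- t]]].

Definition has_crossing n r (Sigma : coloured_perm n r) (k : nat) : bool :=
  has_mono Sigma true (@enh_crossing n) k ||
  has_mono Sigma false (@crossing n) k.

Definition has_nesting n r (Sigma : coloured_perm n r) (k : nat) : bool :=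
  has_mono Sigma true (@enh_nesting n) k ||
  has_mono Sigma false (@nesting n) k.

(** No generality is lost by bounding [k] by [n]; see [crP] and [neP]. *)
Definition cr n r (Sigma : coloured_perm n r) : nat :=
  \max_(k < n.+1 | has_crossing Sigma k) k.

Definition ne n r (Sigma : coloured_perm n r) : nat :=
  \max_(k < n.+1 | has_nesting Sigma k) k.

Definition NCN (j k n r : nat) : nat :=
  #|[set Sigma : coloured_perm n r | (cr Sigma < j) && (ne Sigma < k)]|.

Definition NC (k n r : nat) : nat :=
  #|[set Sigma : coloured_perm n r | cr Sigma < k]|.

Definition NN (k n r : nat) : nat :=
  #|[set Sigma : coloured_perm n r | ne Sigma < k]|.

Lemma size_sorted_left n (s : seq (arc n)) :
  sorted ltn [seq left a | a <- s] -> size s <= n.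
Proof.
move=> /(sorted_uniq ltn_trans ltnn) us.
rewrite -(size_map (@left n)) -[leqRHS](size_iota 0).
apply: uniq_leq_size => // _ /mapP[a _ ->].
by rewrite mem_iota /= add0n ltn_ord.
Qed.

Lemma has_mono_le n r (Sigma : coloured_perm n r) u (P : seq (arc n) -> bool) k :
  (forall s, P s -> sorted ltn [seq left a | a <- s]) ->
  has_mono Sigma u P k -> k <= n.
Proof.
move=> HP /existsP[c /existsP[t /and3P[_ _ /HP/size_sorted_left]]].
by rewrite size_map size_tuple.
Qed.

Lemma has_crossing_le n r (Sigma : coloured_perm n r) k :
  has_crossing Sigma k -> k <= n.
Proof.
case/orP; apply: has_mono_le => s; first by case/and3P.
exact: (subseq_sorted ltn_trans (prefix_subseq _ _)).
Qed.

Lemma has_nesting_le n r (Sigma : coloured_perm n r) k :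
  has_nesting Sigma k -> k <= n.
Proof.
case/orP; apply: has_mono_le => s; first by case/and3P.
exact: (subseq_sorted ltn_trans (prefix_subseq _ _)).
Qed.

Lemma has_mono0 n r (Sigma : coloured_perm n r) u (P : seq (arc n) -> bool) :
  0 < r -> P [::] -> has_mono Sigma u P 0.
Proof.
case: r Sigma => // r Sigma _ P0; apply/existsP; exists ord0.
by apply/existsP; exists [tuple].
Qed.

Lemma bigmax_bounded (P : pred nat) n :
  P 0 -> (forall k, P k -> k <= n) ->
  let m := \max_(k < n.+1 | P k) k in P m /\ forall k, P k -> k <= m.
Proof.
move=> P0 Pn /=; split=> [|k Pk]; last first.
  exact: (@leq_bigmax_cond _ (fun i : 'I_n.+1 => P i) val
            (Ordinal (Pn k Pk : k < n.+1))).
have [i Pi ->] := @eq_bigmax_cond _ [pred i : 'I_n.+1 | P i] val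
  (introT card_gt0P (ex_intro _ ord0 P0)).
exact: Pi.
Qed.

Lemma crP n r (Sigma : coloured_perm n r) : 0 < r ->
  has_crossing Sigma (cr Sigma) /\
  forall k, has_crossing Sigma k -> k <= cr Sigma.
Proof.
move=> r0; apply: bigmax_bounded; last exact: has_crossing_le.
by rewrite /has_crossing has_mono0.
Qed.

Lemma neP n r (Sigma : coloured_perm n r) : 0 < r ->
  has_nesting Sigma (ne Sigma) /\
  forall k, has_nesting Sigma k -> k <= ne Sigma.
Proof.
move=> r0; apply: bigmax_bounded; last exact: has_nesting_le.
by rewrite /has_nesting has_mono0.
Qed.

(* Main.v *)
Require Import Defs.
From mathcomp Require Import all_boot all_fingroup.
From mathcomp Require Import zify.
(* [arc] denotes the type of arcs, not the sub-arc of a cycle. *)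
Import Defs.

Set Implicit Arguments.
Unset Strict Implicit.
Unset Printing Implicit Defensive.

(** Fix the colour and the side (upper or lower) of an arc: the arcs of one
    such class form a matching between the vertices where they open and the
    vertices where they close, and crossings and nestings never mix classes.
    It therefore suffices to exchange crossings and nestings inside every
    class without moving its opening and closing vertices; the classes can
    then be put together again into a coloured permutation.

    Inside one class this is the oscillating tableau correspondence of Chen,
    Deng, Du, Stanley and Yan. Read the diagram from right to left, keeping a
    tableau: at the closing end of an arc, row-insert the position of its
    opening end; at an opening end, that position is the largest entry of the
    tableau, and it is removed. At each moment the tableau is Knuth equivalent
    to the word of the openers of the arcs that span the current position,
    listed by decreasing closer ([knuth_tab]). An increasing subword is a
    nesting and a decreasing one is a crossing ([mono_chainP]), so by
    Schensted's theorem ([increasing_tableau], [decreasing_tableau]) the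
    length of the longest first row is the largest nesting and the largest
    number of rows is the largest crossing.

    A matching is determined by the sequence of shapes it runs through
    ([shapes_inj]), because row insertion and the removal of the largest entry
    can both be undone once the shapes are known; for the same reason every
    walk in Young's lattice that ends at the empty shape comes from a matching
    ([decode]). Transposing all shapes of a walk gives another walk with the
    same up and down steps, that is, a matching with the same openers and
    closers ([conj_profile]), in which rows and columns, hence crossings and
    nestings, are exchanged.

    On coloured permutations this yields an injection that swaps the two
    statistics ([conjugation]), and both equalities follow by comparing
    cardinals in the two directions. *)

(** * Partitions *)

Definition is_part (l : seq nat) := sorted geq l && (0 \notin l).

Definition conj_part (l : seq nat) :=
  [seq count (ltn j) l | j <- iota 0 (head 0 l)].

(** The diagram of [m] is that of [l] plus one cell. Row lengths are compared
    with default [0], so that opening a new row is not a separate case. *)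
Definition covers (l m : seq nat) :=
  exists i, forall i', nth 0 m i' = (i == i') + nth 0 l i'.

Lemma part_cons a l :
  is_part (a :: l) = [&& 0 < a, head 0 l <= a & is_part l].
Proof.
rewrite /is_part /= inE negb_or eq_sym -lt0n.
by case: l => [|b l] /=; case: (0 < a); rewrite ?andbF ?andbT // -andbA.
Qed.

(** Both sides say that the cell in row [i] and column [j] lies in the diagram
    of [l]: every fact on transposition reduces to this one. *)
Lemma part_count l i j : is_part l -> (i < count (ltn j) l) = (j < nth 0 l i).
Proof.
elim: l i => [|a l IHl] i; first by rewrite nth_nil.
rewrite part_cons => /and3P[a0 la pl] /=.
case: i => [|i] /=; last first.
  rewrite -(IHl i pl); case: (ltnP j a) => //= ja.
  rewrite -[RHS]/(_ < _); apply/idP/idP; first lia.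
  suff: 0 < count (ltn j) l -> j < head 0 l by lia.
  by rewrite (IHl 0 pl) nth0.
case: (ltnP j a) => //= ja; rewrite add0n (IHl 0 pl) nth0; lia.
Qed.

Lemma part_nth_inj l m : is_part l -> is_part m ->
  nth 0 l =1 nth 0 m -> l = m.
Proof.
elim: l m => [|a l IHl] [|b m] //.
- by move=> _; rewrite part_cons => /and3P[b0 _ _] /(_ 0) /=; lia.
- by rewrite part_cons => /and3P[b0 _ _] _ /(_ 0) /=; lia.
rewrite !part_cons => /and3P[_ _ pl] /and3P[_ _ pm] e.
by rewrite (IHl m pl pm (fun i => e i.+1)); have /= -> := e 0.
Qed.

Lemma nth_conj l j : is_part l -> nth 0 (conj_part l) j = count (ltn j) l.
Proof.
move=> pl; case: (ltnP j (head 0 l)) => hj.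
  by rewrite (nth_map 0) ?size_iota // nth_iota.
rewrite nth_default ?size_map ?size_iota //; apply/esym/eqP.
by rewrite -leqn0 leqNgt part_count // nth0 -leqNgt.
Qed.

Lemma ltn_nth_conj l i j : is_part l ->
  (i < nth 0 (conj_part l) j) = (j < nth 0 l i).
Proof. by move=> pl; rewrite nth_conj // part_count. Qed.

Lemma part_conj l : is_part l -> is_part (conj_part l).
Proof.
move=> pl; apply/andP; split.
  rewrite /conj_part sorted_map; apply: sub_sorted (iota_ltn_sorted _ _).
  by move=> i j /= ij; apply: sub_count => a /=; lia.
apply/mapP => -[j]; rewrite mem_iota add0n => /andP[_ hj] /esym/eqP.
by rewrite -leqn0 leqNgt part_count // nth0 hj.
Qed.

Lemma head_conj l : is_part l -> head 0 (conj_part l) = size l.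
Proof.
move=> pl; rewrite -nth0 nth_conj // -[RHS]count_predT; apply: eq_in_count.
move=> a al /=; move: pl => /andP[_]; case: a al => // al; by rewrite al.
Qed.

Lemma size_conj l : size (conj_part l) = head 0 l.
Proof. by rewrite size_map size_iota. Qed.

Lemma conj_partK l : is_part l -> conj_part (conj_part l) = l.
Proof.
move=> pl; apply: part_nth_inj => //; first exact/part_conj/part_conj.
move=> i; have pc := part_conj pl.
have e j : (j < nth 0 (conj_part (conj_part l)) i) = (j < nth 0 l i).
  by rewrite !ltn_nth_conj.
have := e (nth 0 l i); have := e (nth 0 (conj_part (conj_part l)) i).
by rewrite !ltnn; lia.
Qed.

(** The added cell is at the end of row [i0], so in the transposed diagram it
    is at the end of row [nth 0 l i0]; cells are then compared one by one. *)
Lemma covers_conj l m : is_part l -> is_part m ->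
  covers l m -> covers (conj_part l) (conj_part m).
Proof.
move=> pl pm [i0 e]; exists (nth 0 l i0) => j.
have lt i : (i < nth 0 (conj_part m) j) =
    (i < nth 0 (conj_part l) j) || ((i == i0) && (j == nth 0 l i0)).
  rewrite !ltn_nth_conj // e; case: (eqVneq i0 i) => [<-|ne] /=.
    by lia.
  by rewrite orbF.
have at0 : nth 0 l i0 = j -> nth 0 (conj_part l) j = i0.
  move=> ej.
  have := ltn_nth_conj i0 j pl; have := ltn_nth_conj i0 j pm.
  rewrite e ej => h1 h2.
  have := ltn_nth_conj (nth 0 (conj_part l) j) j pl.
  have := ltn_nth_conj (nth 0 (conj_part l) j) j pm.
  have := lt (nth 0 (conj_part l) j).
  rewrite ej eqxx andbT ltnn; lia.
have := lt (nth 0 (conj_part m) j); have := lt (nth 0 (conj_part l) j).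
have := lt (nth 0 (conj_part l) j).+1.
rewrite !ltnn; case: (eqVneq (nth 0 l i0) j) => [ej|ne] /=.
  rewrite (at0 ej); lia.
rewrite ?andbF; lia.
Qed.

(** * Row insertion *)

(** Rows are compared through the number of their entries below each
    threshold. This replaces column indices, which are awkward to follow when
    an entry is bumped: a bump only shifts these numbers between two
    thresholds. *)
Definition below v (s : seq nat) := count (fun a => a < v) s.
Arguments below : simpl never.

(** Bumping the least entry [>= x], rather than [> x], keeps the rows strictly
    increasing for all words, repeated letters included. *)
Fixpoint row_insert x (r : seq nat) : seq nat * option nat :=
  if r is y :: r' then
    if x <= y then (x :: r', Some y)
    else let: (r'', o) := row_insert x r' in (y :: r'', o)
  else ([:: x], None).

Fixpoint insert x (T : seq (seq nat)) : seq (seq nat) :=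
  if T is r :: T' then
    let: (r', o) := row_insert x r in
    if o is Some y then r' :: insert y T' else r' :: T'
  else [:: [:: x]].

(** For increasing rows: [s] fits under [r] with weakly increasing columns. *)
Definition dominates (r s : seq nat) := forall v, below v s <= below v r.

Fixpoint tableau (T : seq (seq nat)) : Prop :=
  if T is r :: T' then
    [/\ r != [::], sorted ltn r, dominates r (head [::] T') & tableau T']
  else True.

Lemma path_ltnE a s : path ltn a s = all (ltn a) s && sorted ltn s.
Proof. exact: path_sortedE ltn_trans a s. Qed.

Definition sorted_cons :=
  (path_ltnE, fun a s => path_ltnE a s : sorted ltn (a :: s) = _).

Lemma below_cons v a s : below v (a :: s) = (a < v) + below v s.
Proof. by []. Qed.

Lemma below_all v s : all (gtn v) s -> below v s = size s.
Proof. by move=> h; apply/eqP; rewrite -all_count. Qed.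

Lemma below_size v s : below v s <= size s.
Proof. exact: count_size. Qed.

Lemma below_le v w s : v <= w -> below v s <= below w s.
Proof. by move=> vw; apply: sub_count => a /= av; apply: leq_trans av vw. Qed.

Lemma below_lt v w y s : v <= y -> y \in s -> y < w -> below v s < below w s.
Proof.
move=> vy ys yw; elim: s ys => //= a s IHs; rewrite inE !below_cons.
have := @below_le v w s; case: eqP => [<-|_] /= h; first lia.
by move/IHs; lia.
Qed.

(** The last clause says that [y] is the least entry of [r] that is at least
    [x]: no entry lies in between. *)
Lemma row_insert_bump x r r' y : sorted ltn r -> row_insert x r = (r', Some y) ->
  [/\ [/\ sorted ltn r', size r' = size r & head 0 r' <= x],
      [/\ x <= y, y \in r & x \in r'],
      forall v, below v r' + (y < v) = below v r + (x < v)
    & forall v, x <= v -> v <= y -> below v r = below x r].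
Proof.
elim: r r' => //= z r IHr r' sr; case: (leqP x z) => xz.
  move=> [<- <-]; move: (sr); rewrite !sorted_cons.
  move=> /andP[/allP az sr1]; split => //.
  - split => //; rewrite ?sr1 ?andbT.
    by apply/allP => a /az /=; lia.
  - by split=> //; rewrite ?inE ?eqxx.
  - by move=> v; rewrite !below_cons; lia.
  - move=> v xv vz; rewrite !below_cons.
    have b0 w : w <= z -> below w r = 0.
      move=> wz; apply/eqP; rewrite -leqn0 leqNgt -has_count.
      by apply/hasPn => a /az /=; lia.
    by rewrite !b0 //; lia.
move: (sr); rewrite sorted_cons => /andP[/allP az sr1].
case e: (row_insert x r) => [s o] [<- eo]; rewrite eo in e.
have [[ss sz hs] [xy yr xs] b1 b2] := IHr s sr1 e.
split.
- split; [|by rewrite /= sz|by apply: ltnW].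
  rewrite sorted_cons ss andbT; apply/allP => a.
  case: s e xs b1 b2 {IHr sz} ss hs => // b s e xs b1 b2.
  rewrite sorted_cons => /andP[/allP bs _] _ /= ha.
  have zb : z < b.
    case: r e az {sr sr1 yr b1 b2} => //= c r; case: ifP => _.
      by move=> [<- _ _].
    by case: (row_insert x r) => r1 o1 [<- _ _] /(_ c); apply; rewrite inE eqxx.
  by move: ha; rewrite inE => /orP[/eqP ->//|/bs /=]; lia.
- by split=> //; rewrite inE ?yr ?xs orbT.
- by move=> v; rewrite !below_cons; have := b1 v; lia.
- by move=> v xv vy; rewrite !below_cons (b2 v) //; lia.
Qed.

Lemma row_insert_end x r r' : sorted ltn r -> row_insert x r = (r', None) ->
  r' = rcons r x /\ all (gtn x) r.
Proof.
elim: r r' => [|z r IHr] r' /=; first by move=> _ [<-].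
rewrite sorted_cons => /andP[_ sr].
case: leqP => // zx; case e: (row_insert x r) => [s o] [<- eo].
by rewrite eo in e; have [-> ->] := IHr s sr e.
Qed.

Lemma row_insert_rcons x r : all (gtn x) r -> row_insert x r = (rcons r x, None).
Proof. by elim: r => //= z r IHr /andP[zx /IHr ->]; rewrite leqNgt zx. Qed.

Lemma sorted_rcons r x :
  sorted ltn (rcons r x) = all (gtn x) r && sorted ltn r.
Proof.
elim: r => //= a r IHr; rewrite !sorted_cons IHr all_rcons /=.
by rewrite -!andbA; do !bool_congr.
Qed.

(** The lower row gains an entry below [v] only for thresholds [v] that exceed
    [y] and do not exceed the entry bumped from [s]. As [s] has no entry
    between [y] and [v], its count below [v] is at most that of [r] below [y],
    and [y] is one more entry of [r] below [v]. *)
Lemma dominates_insert r s x r' y s' o : sorted ltn r -> sorted ltn s ->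
  dominates r s -> row_insert x r = (r', Some y) -> row_insert y s = (s', o) ->
  dominates r' s'.
Proof.
move=> sr ss d er es v.
have [[sr' szr hr] [xy yr xr] b1 b2] := row_insert_bump sr er.
have key : y < v -> below y r + 1 <= below v r.
  by rewrite addn1; exact: (below_lt (leqnn y)).
have := b1 v; have := d v; have := d y.
case: o es => [z|] es; last first.
  have [-> al] := row_insert_end ss es.
  rewrite /below -cats1 count_cat /= -!/(below _ _).
  case: (ltnP y v) => yv; last by lia.
  have e w : y <= w -> below w s = size s.
    by move=> yw; apply: below_all; apply: sub_all al => a /=; lia.
  by have := key yv; rewrite !e //; lia.
have [_ [yz _ _] c1 c2] := row_insert_bump ss es.
have := c1 v; case: (ltnP y v) => yv; last by lia.
case: (ltnP z v) => zv; first by lia.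
by have := key yv; rewrite (c2 v) //; lia.
Qed.

Lemma tableau_insert x T : tableau T -> tableau (insert x T).
Proof.
elim: T x => [|r T IHT] x; first by split=> // v.
move=> [r0 sr d tT] /=; case e: (row_insert x r) => [r' [y|]]; last first.
  have [-> al] := row_insert_end sr e; split=> //.
  - by case: (r).
  - by rewrite sorted_rcons al.
  - move=> v; apply: leq_trans (d v) _; rewrite /below -cats1 count_cat.
    exact: leq_addr.
have [[sr' szr _] [xy yr xr'] b1 _] := row_insert_bump sr e.
split=> //; last exact: IHT.
  by case: (r') xr'.
case: T d tT {IHT} => [|s T] /= d tT.
  move=> v; rewrite /below /= addn0; case: ltnP => //= yv.
  by rewrite -has_count; apply/hasP; exists x => //; lia.
case e2: (row_insert y s) => [s' o]; have [_ ss _ _] := tT.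
by case: o e2 => [z|] e2 /=; apply: (dominates_insert sr ss d e e2).
Qed.

Lemma perm_row_insert x r r' o : row_insert x r = (r', o) ->
  perm_eq (if o is Some y then y :: r' else r') (x :: r).
Proof.
move=> e; apply/seq.permP => P; elim: r r' o e => [|y r IHr] r' o /=.
  by move=> [<- <-].
case: leqP => _; first by move=> [<- <-] /=; lia.
case e: (row_insert x r) => [s o'] [<- <-] /=.
by have := IHr _ _ e; case: (o') => [z|] /=; lia.
Qed.

Lemma perm_insert x T : perm_eq (flatten (insert x T)) (x :: flatten T).
Proof.
apply/seq.permP => P; elim: T x => [|r T IHT] x //=; rewrite count_cat.
case e: (row_insert x r) => [r' o]; have /seq.permP/(_ P) := perm_row_insert e.
case: o e => [y|] e /=; rewrite count_cat; last by lia.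
by rewrite IHT /=; lia.
Qed.

Lemma part_shape T : tableau T -> is_part (shape T).
Proof.
elim: T => //= r T IHT [r0 sr d tT]; rewrite part_cons IHT // andbT.
rewrite lt0n size_eq0 r0 /=; case: T d {IHT tT} => //= s T d.
pose v := (\max_(a <- s) a).+1.
have <- : below v s = size s.
  by apply: below_all; apply/allP => a ha /=; rewrite ltnS leq_bigmax_seq.
exact: leq_trans (d v) (below_size v r).
Qed.

Lemma covers_insert x T : tableau T -> covers (shape T) (shape (insert x T)).
Proof.
elim: T x => [|r T IHT] x; first by move=> _; exists 0; case=> [|i'] //=; rewrite nth_nil.
move=> [r0 sr d tT] /=; case e: (row_insert x r) => [r' [y|]]; last first.
  have [-> _] := row_insert_end sr e.
  by exists 0; case=> [|i'] //=; rewrite size_rcons.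
have [[_ szr _] _ _ _] := row_insert_bump sr e.
have [i hi] := IHT y tT.
by exists i.+1; case=> [|i'] //=; rewrite hi.
Qed.

(** If one insertion bumped at the head of its row and the other did not, the
    common row would contain, after its head, both only entries larger than
    [y] and an inserted letter that is at most [y]. *)
Lemma row_insert_inj x1 x2 r1 r2 r y : sorted ltn r1 -> sorted ltn r2 ->
  row_insert x1 r1 = (r, Some y) -> row_insert x2 r2 = (r, Some y) ->
  x1 = x2 /\ r1 = r2.
Proof.
elim: r1 r2 r => [|z1 r1 IHr] [|z2 r2] r //= h1 h2.
move: (h1) (h2); rewrite !sorted_cons.
move=> /andP[/allP a1 s1] /andP[/allP a2 s2].
case: (leqP x1 z1) => c1; case: (leqP x2 z2) => c2.
- by move=> [<- <-] [-> -> ->].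
- case e: (row_insert x2 r2) => [t o] [<- <-] [z2x1 tr eo]; subst.
  by have [_ [cy _ /a1 /=]] := row_insert_bump s2 e; lia.
- case e: (row_insert x1 r1) => [t o] [<- eo] [z2x1 tr ey]; subst.
  by have [_ [cy _ /a2 /=]] := row_insert_bump s1 e; lia.
case e1: (row_insert x1 r1) => [t1 o1] [<- eo1].
case e2: (row_insert x2 r2) => [t2 o2] [-> et eo2]; subst.
by have [-> ->] := IHr _ _ s1 s2 e1 e2.
Qed.

Lemma insert_inj x1 x2 T1 T2 : tableau T1 -> tableau T2 ->
  shape T1 = shape T2 -> insert x1 T1 = insert x2 T2 -> x1 = x2 /\ T1 = T2.
Proof.
elim: T1 T2 x1 x2 => [|r1 T1 IHT] [|r2 T2] x1 x2 //=; first by move=> _ _ _ [->].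
move=> [n1 s1 d1 t1] [n2 s2 d2 t2] [sz sh].
case e1: (row_insert x1 r1) => [u1 o1]; case e2: (row_insert x2 r2) => [u2 o2].
case: o1 o2 e1 e2 => [y1|] [y2|] e1 e2.
- move=> [eu eT]; have [ey eT'] := IHT _ _ _ t1 t2 sh eT; subst.
  by have [-> ->] := row_insert_inj s1 s2 e1 e2.
- have [[_ h _] _ _ _] := row_insert_bump s1 e1.
  have [h2 _] := row_insert_end s2 e2.
  by move=> [eu _]; move: (congr1 size eu); rewrite h2 size_rcons h sz; lia.
- have [[_ h _] _ _ _] := row_insert_bump s2 e2.
  have [h2 _] := row_insert_end s1 e1.
  by move=> [eu _]; move: (congr1 size eu); rewrite h2 size_rcons h sz; lia.
have [-> _] := row_insert_end s1 e1; have [-> _] := row_insert_end s2 e2.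
by move=> [/rcons_inj[-> ->] ->].
Qed.

(** Reverse bumping: [y] takes the place of the largest entry [<= y]. The last
    clause records that nothing lies between that entry and [y]. *)
Lemma row_insert_surj r' y : sorted ltn r' -> r' != [::] -> head 0 r' <= y ->
  exists x r, [/\ sorted ltn r, row_insert x r = (r', Some y)
    & forall v, x < v -> v <= y.+1 -> below v r' = below y.+1 r'].
Proof.
elim: r' => //= z r' IHr sr _ zy; move: (sr).
rewrite sorted_cons => /andP[/allP al s1].
case: (boolP ((r' != [::]) && (head 0 r' <= y))) => [/andP[r0 h]|h].
  have [x [r [ss e b]]] := IHr s1 r0 h.
  have [_ [xy yr xr'] _ _] := row_insert_bump ss e.
  have zx := al x xr'; rewrite /= in zx.
  exists x, (z :: r); rewrite sorted_cons ss andbT /= leqNgt zx /= e; split=> //.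
    have /perm_mem hm := perm_row_insert e; apply/allP => a ar.
    have : a \in y :: r' by rewrite hm inE ar orbT.
    by rewrite inE => /orP[/eqP ->/=|/al //]; lia.
  by move=> v xv vy; rewrite !below_cons b //; lia.
have al2 : all (ltn y) r'.
  case: r' h s1 {al IHr sr} => //= b r'; rewrite -ltnNge => yb.
  rewrite sorted_cons => /andP[/allP hb _].
  by rewrite yb /=; apply/allP => a /hb /=; lia.
exists z, (y :: r'); rewrite sorted_cons al2 s1 /= zy; split=> //.
move=> v zv vy; rewrite !below_cons zv ltnS zy.
have b0 w : w <= y.+1 -> below w r' = 0.
  move=> wy; apply/eqP; rewrite -leqn0 leqNgt -has_count.
  by apply/hasPn => a /(allP al2) /=; lia.
by rewrite !b0.
Qed.

(** Splits the diagrams along their first rows, as tableaux are split. *)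
Lemma coversP l m : is_part l -> is_part m -> covers l m ->
  match l, m with
  | [::], _ => m = [:: 1]
  | a :: l', b :: m' => b = a.+1 /\ l' = m' \/ a = b /\ covers l' m'
  | _ :: _, [::] => False
  end.
Proof.
move=> pl pm [i e]; case: l pl e => [|a l] pl e.
  have e' k : nth 0 m k = (i == k) by rewrite e nth_nil addn0.
  have i0 : i = 0.
    case: i {e} e' => // i; case: m pm => [|b m] pm e'.
      by have := e' i.+1; rewrite nth_nil eqxx.
    by have := e' 0; move: pm; rewrite part_cons /= => /and3P[b0 _ _]; lia.
  apply: part_nth_inj => // k; rewrite e' i0.
  by case: k => //= k; rewrite nth_nil.
case: m pm e => [|b m] pm e.
  by have := e 0; move: pl; rewrite part_cons /= => /and3P[a0 _ _]; lia.
move: pl pm; rewrite !part_cons => /and3P[_ _ pl] /and3P[_ _ pm].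
case: i e => [|i] e.
  left; split; first by have := e 0.
  by apply: part_nth_inj => // k; have := e k.+1.
right; split; first by have := e 0.
by exists i => k; have := e k.+1.
Qed.

(** Mirror image of [dominates_insert]: for [x < v <= y] the upper row loses an
    entry below [v], and the presence of [y] in [s'] provides the slack. *)
Lemma dominates_reverse r s x r' y s' o : sorted ltn r -> sorted ltn s ->
  dominates r' s' -> row_insert x r = (r', Some y) -> row_insert y s = (s', o) ->
  (forall v, x < v -> v <= y.+1 -> below v r' = below y.+1 r') ->
  dominates r s.
Proof.
move=> sr ss d er es b v.
have [[sr' szr hr] [xy yr xr] b1 _] := row_insert_bump sr er.
have ys' : y \in s'.
  case: o es => [z|] es; first by have [_ []] := row_insert_bump ss es.
  by have [-> _] := row_insert_end ss es; rewrite mem_rcons inE eqxx.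
have c1 : below v s <= below v s' /\ below v s + (y < v) <= below v s' + 1
    /\ (v <= y -> below v s = below v s').
  case: o es => [z|] es; last first.
    have [-> _] := row_insert_end ss es.
    by rewrite /below -cats1 count_cat /= -!/(below _ _); lia.
  by have [_ [yz _ _] c1 c2] := row_insert_bump ss es; have := c1 v; lia.
have := b1 v; have := d v.
case: (ltnP x v) => xv; last by lia.
case: (ltnP y v) => yv; first by lia.
have key := below_lt yv ys' (ltnSn y).
by have := d y.+1; rewrite (b v) //; lia.
Qed.

Lemma head_dominates r s : sorted ltn r -> dominates r s -> s != [::] ->
  r != [::] /\ head 0 r <= head 0 s.
Proof.
case: s => // b s sr d _; have := d b.+1; rewrite below_cons ltnSn.
case: r sr {d} => // a r; rewrite sorted_cons => /andP[/allP al _] h; split=> //=.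
rewrite leqNgt; apply/negP => ba; move: h; rewrite below_cons.
suff -> : below b.+1 r = 0 by lia.
apply/eqP; rewrite -leqn0 leqNgt -has_count; apply/hasPn => c /al /=; lia.
Qed.

(** The entry at the end of the row where the two shapes differ is popped out
    and reverse bumped through the rows above. It can always replace an entry
    of the next row up, because columns increase weakly downwards. *)
Lemma insert_surj l T' : tableau T' -> is_part l -> covers l (shape T') ->
  exists x T, [/\ tableau T, shape T = l & insert x T = T'].
Proof.
elim: T' l => [|r' T' IHT] l tT' pl /(coversP pl (part_shape tT')).
  by case: l pl.
move: (tT') => [r0 sr' d' tT]; case: l pl => [|a l] pl.
  case: r' r0 sr' tT' d' => [|x [|? ?]] //= _ _ _ _; case: T' {tT IHT} => //= _.
  by exists x, [::].
move=> /=; move: (pl); rewrite part_cons => /and3P[a0 la pl'].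
case=> [[sz el]|[az cov]].
  case/lastP: r' r0 sr' tT' d' sz => // r x _ sr' _ d'; rewrite size_rcons.
  move=> [sz]; move: sr'; rewrite sorted_rcons => /andP[al sr].
  exists x, (r :: T'); rewrite /= row_insert_rcons // sz el; split=> //.
  split=> //; first by rewrite -size_eq0 sz -lt0n.
  move=> v; have := d' v; rewrite /below -cats1 count_cat /= -!/(below _ _).
  case: (ltnP x v) => xv; last by rewrite !addn0.
  move=> _; rewrite (@below_all v r) ?sz; last by apply: sub_all al => c /=; lia.
  apply: leq_trans (below_size _ _) _.
  by move: la; rewrite el; case: (T').
have [y [T [tT1 shT eT]]] := IHT l tT pl' cov.
have T'0 : head [::] T' != [::] /\ head 0 (head [::] T') <= y.
  rewrite -eT; case: T tT1 {shT eT} => //= s T [_ ss _ _].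
  case e: (row_insert y s) => [s' [z|]] /=.
    have [[_ _ h] [_ _ ys] _ _] := row_insert_bump ss e; split=> //.
    by case: (s') ys.
  have [-> al] := row_insert_end ss e.
  by split; case: (s) al => //= c u /andP[/ltnW].
have [_ hle] := head_dominates sr' d' T'0.1.
have [x [r [sr e b]]] := row_insert_surj sr' r0 (leq_trans hle T'0.2).
have [[_ szr _] [_ yr _] _ _] := row_insert_bump sr e.
exists x, (r :: T); rewrite /= e eT shT -szr az; split=> //; split=> //.
  by case: (r) yr.
case: T tT1 eT {shT} => [|s T] /= tT1 eT v; first by [].
have [_ ss _ _] := tT1.
case e2: (row_insert y s) eT => [s' o] eT.
apply: (dominates_reverse (s' := s') sr ss _ e e2 b).
by move: d'; rewrite -eT; case: (o).
Qed.

(** * Removing and adding the largest entry *)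

Definition keep_below p (s : seq nat) := [seq a <- s | a < p].

(** Once a row has lost all its entries, so have the rows below it; stopping
    there keeps empty rows out of tableaux. *)
Fixpoint restrict p (T : seq (seq nat)) : seq (seq nat) :=
  if T is r :: T' then
    if keep_below p r is [::] then [::] else keep_below p r :: restrict p T'
  else [::].

Lemma keep_below_nil p s : below p s = 0 -> keep_below p s = [::].
Proof. by move=> h; apply: size0nil; rewrite size_filter. Qed.

Lemma keep_below_id p s : all (gtn p) s -> keep_below p s = s.
Proof. by move=> /all_filterP. Qed.

Lemma below_keep v p s : below v (keep_below p s) = below (minn v p) s.
Proof. by rewrite /below count_filter; apply: eq_count => a /=; lia. Qed.

Lemma restrict_cons p r T : keep_below p r != [::] ->
  restrict p (r :: T) = keep_below p r :: restrict p T.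
Proof. by move=> /=; case: (keep_below p r). Qed.

Lemma restrict_cons0 p r T : keep_below p r = [::] -> restrict p (r :: T) = [::].
Proof. by move=> /= ->. Qed.

Lemma head_restrict p T : head [::] (restrict p T) = keep_below p (head [::] T).
Proof. by case: T => //= r T; case: (keep_below p r). Qed.

Arguments restrict : simpl never.

Lemma tableau_restrict p T : tableau T -> tableau (restrict p T).
Proof.
elim: T => // r T IHT [r0 sr d tT].
case: (eqVneq (keep_below p r) [::]) => h; first by rewrite restrict_cons0.
rewrite restrict_cons //; split=> //; last exact: IHT.
  exact: (sorted_filter ltn_trans).
by move=> v; rewrite head_restrict !below_keep; apply: d.
Qed.

Lemma keep_below_flatten0 p T : tableau T -> below p (head [::] T) = 0 ->
  keep_below p (flatten T) = [::].
Proof.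
elim: T => //= r T IHT [r0 sr d tT] h; rewrite /keep_below filter_cat.
rewrite -!/(keep_below _ _) keep_below_nil // IHT //.
by apply/eqP; rewrite -leqn0 -h; apply: d.
Qed.

Lemma flatten_restrict p T : tableau T ->
  flatten (restrict p T) = keep_below p (flatten T).
Proof.
elim: T => // r T IHT tT; have [r0 sr d tT'] := tT.
case: (eqVneq (keep_below p r) [::]) => h.
  rewrite restrict_cons0 // keep_below_flatten0 //=.
  by rewrite /below -size_filter -/(keep_below p r) h.
by rewrite restrict_cons //= IHT // /keep_below filter_cat.
Qed.

Lemma restrict_id p T : tableau T -> all (gtn p) (flatten T) -> restrict p T = T.
Proof.
elim: T => // r T IHT [r0 sr d tT]; rewrite [flatten _]/= all_cat.
by move=> /andP[hr hT]; rewrite restrict_cons keep_below_id // IHT.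
Qed.

(** Inverse of [restrict]: the cell by which the shape grows receives [p],
    which exceeds all entries. *)
Lemma tableau_grow p T l : tableau T -> all (gtn p) (flatten T) ->
  is_part l -> covers (shape T) l ->
  exists T', [/\ tableau T', shape T' = l, restrict p T' = T
               & perm_eq (flatten T') (p :: flatten T)].
Proof.
elim: T l => [|r T IHT] l tT hT pl /(coversP (part_shape tT) pl).
  move=> /= ->; exists [:: [:: p]]; split=> //.
  by rewrite /restrict /= ltnn.
move: hT; rewrite [flatten _]/= all_cat => /andP[hr hT].
case: tT => r0 sr d tT.
case: l pl => [|b l] pl /=; first by [].
case=> [[eb el]|[eb cov]].
  exists (rcons r p :: T); split=> //=; last 2 first.
  - have k : keep_below p (rcons r p) = r.
      by rewrite /keep_below filter_rcons ltnn; exact: keep_below_id.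
    by rewrite restrict_cons k // restrict_id.
  - by rewrite cat_rcons; apply/seq.permP => P; rewrite /= !count_cat /=; lia.
  - split=> //; first by case: (r).
      by rewrite sorted_rcons hr.
    move=> v; apply: leq_trans (d v) _; rewrite /below -cats1 count_cat.
    exact: leq_addr.
  by rewrite size_rcons eb -el.
move: (pl); rewrite part_cons => /and3P[_ hb pl'].
have [T' [tT' shT' eT' pT']] := IHT l tT hT pl' cov.
exists (r :: T'); split.
- split=> //; move=> v; case: (ltnP p v) => pv.
    rewrite (@below_all v r); last by apply: sub_all hr => a /=; lia.
    apply: leq_trans (below_size _ _) _; rewrite eb; apply: leq_trans hb.
    by rewrite -shT'; case: (T').
  rewrite -(minn_idPl pv) -below_keep -head_restrict eT'.
  by apply: leq_trans (d v) _; rewrite (minn_idPl pv).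
- by rewrite /= shT' eb.
- by rewrite restrict_cons keep_below_id // eT'.
- apply/seq.permP => P; have /seq.permP/(_ P) := pT'.
  by rewrite /= !count_cat; lia.
Qed.

Lemma row_top p r : sorted ltn r -> all (gtn p.+1) r ->
  r = keep_below p r ++ nseq (size r - size (keep_below p r)) p.
Proof.
elim: r => // a r IHr; rewrite sorted_cons /= => /andP[/allP al sr] /andP[ap hr].
case: (ltnP a p) => h; first by rewrite /= subSS -IHr.
have ep : a = p by apply/eqP; rewrite eqn_leq h -ltnS ap.
suff -> : r = [::] by rewrite /= ep.
case: r al hr {IHr sr} => // b r al /= /andP[hb _].
by have := al b; rewrite inE eqxx => /(_ isT) /=; lia.
Qed.

Lemma tableau_top p T : tableau T -> all (gtn p.+1) (flatten T) ->
  below p (head [::] T) = 0 -> T = nseq (size T) [:: p].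
Proof.
elim: T => //= r T IHT [r0 sr d tT]; rewrite all_cat => /andP[hr hT] h.
rewrite -IHT //; last by apply/eqP; rewrite -leqn0 -h; apply: d.
congr (_ :: _); have := row_top sr hr; rewrite keep_below_nil // subn0 /=.
case: r r0 sr {d hr h} => //= a [|b r] _ ; first by move=> _ [->].
by rewrite sorted_cons /= => h [ea eb _]; move: h; rewrite ea eb ltnn.
Qed.

(** Each row is recovered from its restriction by padding with copies of [p]
    up to the length that the shape prescribes ([row_top]). *)
Lemma restrict_inj p T1 T2 : tableau T1 -> tableau T2 ->
  all (gtn p.+1) (flatten T1) -> all (gtn p.+1) (flatten T2) ->
  shape T1 = shape T2 -> restrict p T1 = restrict p T2 -> T1 = T2.
Proof.
elim: T1 T2 => [|r1 T1 IHT] [|r2 T2] // t1 t2 h1 h2 sh e.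
have nil r T : keep_below p r = [::] -> tableau (r :: T) ->
    all (gtn p.+1) (flatten (r :: T)) -> r :: T = nseq (size (r :: T)) [:: p].
  move=> k0 tT hT; apply: tableau_top => //=.
  by rewrite /below -size_filter -/(keep_below p r) k0.
move: e; case: (eqVneq (keep_below p r1) [::]) => k1;
  case: (eqVneq (keep_below p r2) [::]) => k2.
- rewrite (nil r1 T1) // (nil r2 T2) // => _.
  by have := congr1 size sh; rewrite !size_map => ->.
- by rewrite restrict_cons0 // restrict_cons.
- by rewrite restrict_cons // restrict_cons0.
rewrite !restrict_cons // => -[er eT].
move: sh h1 h2; rewrite /= !all_cat => -[sr sT] /andP[h1 h1'] /andP[h2 h2'].
have [_ s1 _ u1] := t1; have [_ s2 _ u2] := t2; congr (_ :: _); last exact: IHT.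
by rewrite (row_top s1 h1) (row_top s2 h2) er sr.
Qed.

(** The largest entry sits at the end of its row with nothing below it. *)
Lemma covers_restrict p T : tableau T -> uniq (flatten T) ->
  all (gtn p.+1) (flatten T) -> p \in flatten T ->
  covers (shape (restrict p T)) (shape T).
Proof.
elim: T => // r T IHT [r0 sr d tT]; rewrite [flatten _]/= cat_uniq all_cat.
move=> /and3P[ur /hasPn dis uT] /andP[hr hT]; rewrite mem_cat => pin.
have hp : p \in r -> all (gtn p) (flatten T).
  move=> pr; apply/allP => a aT; have /= := allP hT a aT.
  by have := dis a aT; case: (eqVneq a p) => [->|]; [rewrite /= pr|lia].
case: (boolP (p \in r)) pin => pr /= pT.
  have rr := row_top sr hr.
  have sz : size r = (size (keep_below p r)).+1.
    have : count_mem p r = 1 by rewrite count_uniq_mem // pr.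
    rewrite [X in count_mem p X]rr count_cat.
    have -> : count_mem p (keep_below p r) = 0.
      by apply/eqP; rewrite -leqn0 leqNgt -has_count has_pred1 mem_filter ltnn.
    by rewrite count_nseq /= eqxx mul1n => h; move: (congr1 size rr) h;
       rewrite size_cat size_nseq; lia.
  case: (eqVneq (keep_below p r) [::]) => k.
    rewrite restrict_cons0 //; exists 0; rewrite /= sz k.
    suff -> : T = [::] by case=> [|i] //=; rewrite !nth_nil.
    have [_ _ _ tT0] := (And4 r0 sr d tT).
    case: T tT hT dis uT d hp {IHT tT0} => // s T [s0 _ _ _] _ _ _ d hp.
    have e0 : below p r = 0 by rewrite /below -size_filter -/(keep_below p r) k.
    have := d p; rewrite e0 leqn0 /= below_all; first by case: (s) s0.
    by move: (hp pr); rewrite /= all_cat => /andP[].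
  rewrite restrict_cons // (restrict_id tT (hp pr)).
  by exists 0; case=> [|i] //=; rewrite sz.
have kr : keep_below p r = r.
  apply: keep_below_id; apply/allP => a ar; have /= := allP hr a ar.
  by case: (eqVneq a p) ar => [->|]; [rewrite (negPf pr)|lia].
rewrite restrict_cons kr //; have [i hi] := IHT tT uT hT pT.
by exists i.+1; case=> [|i'] //=; rewrite hi.
Qed.

(** * Event sequences and their tableaux *)

(** A matching on the positions [p], [p + 1], ... is a sequence of events: a
    closer carries [Some x] where [x] is the position of its opener, all other
    positions carry [None]. The list may be a suffix of a larger matching,
    with some openers before [p]. *)
Definition letters (es : seq (option nat)) := pmap id es.

(** Reading from the right, every closer has its opener on its left, no opener
    is used twice, and no closer is itself an opener. *)
Fixpoint valid p (es : seq (option nat)) :=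
  if es is o :: es' then
    valid p.+1 es' &&
    (if o is Some x then [&& x < p, x \notin letters es' & p \notin letters es']
     else true)
  else true.

(** Restriction to the entries below [p] does something only when [p] is an
    opener, whose arc is then left on the right. *)
Fixpoint tab p (es : seq (option nat)) :=
  if es is o :: es' then
    let T := restrict p (tab p.+1 es') in
    if o is Some x then insert x T else T
  else [::].

(** The shape at [p] itself is left out: at position [0] it is empty. *)
Fixpoint shapes p (es : seq (option nat)) :=
  if es is _ :: es' then shape (tab p.+1 es') :: shapes p.+1 es' else [::].

Fixpoint shape_path a (L : seq (seq nat)) : Prop :=
  is_part a /\
  if L is b :: L' then [\/ a = b, covers a b | covers b a] /\ shape_path b L'
  else a = [::].

Lemma tableau_tab p es : tableau (tab p es).
Proof.
elim: es p => //= o es IHes p; have tT := tableau_restrict p (IHes p.+1).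
by case: o => // x; apply: tableau_insert.
Qed.

Lemma perm_tab p es : valid p es ->
  perm_eq (flatten (tab p es)) (keep_below p (letters es)).
Proof.
elim: es p => // o es IHes p /= /andP[/IHes h ho].
have hr : perm_eq (flatten (restrict p (tab p.+1 es))) (keep_below p (letters es)).
  rewrite flatten_restrict; last exact: tableau_tab.
  suff <- : keep_below p (keep_below p.+1 (letters es)) = keep_below p (letters es).
    exact: perm_filter.
  by rewrite /keep_below -filter_predI; apply: eq_filter => a /=; lia.
case: o ho => [x /and3P[xp _ _]|_]; last exact: hr.
apply: (perm_trans (perm_insert _ _)); rewrite /letters /= xp perm_cons.
exact: hr.
Qed.

Lemma mem_tab p es x : valid p es ->
  (x \in flatten (tab p es)) = (x < p) && (x \in letters es).
Proof. by move=> /perm_tab/perm_mem ->; rewrite mem_filter. Qed.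

Lemma uniq_letters p es : valid p es -> uniq (letters es).
Proof.
elim: es p => //= -[x|] es IHes p /andP[/IHes u] //=.
by case/and3P=> _ xl _; rewrite xl.
Qed.

Lemma uniq_tab p es : valid p es -> uniq (flatten (tab p es)).
Proof.
move=> v; rewrite (perm_uniq (perm_tab v)) filter_uniq //.
exact: uniq_letters v.
Qed.

Lemma below_tab p es : valid p es -> all (gtn p) (flatten (tab p es)).
Proof. by move=> v; apply/allP => x; rewrite mem_tab // => /andP[]. Qed.

Lemma restrict_tab p es : valid p.+1 es -> p \notin letters es ->
  restrict p (tab p.+1 es) = tab p.+1 es.
Proof.
move=> v pl; apply: restrict_id; first exact: tableau_tab.
apply/allP => x; rewrite mem_tab // => /andP[xp xl] /=.
by case: (eqVneq x p) xl => [->|]; [rewrite (negPf pl)|lia].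
Qed.

(** Closers, openers and idle positions are told apart by the shapes. *)
Lemma covers_step p o es : valid p (o :: es) ->
  let a := shape (tab p (o :: es)) in let b := shape (tab p.+1 es) in
  if o is Some x then covers b a else if p \in letters es then covers a b
  else a = b.
Proof.
move=> /= /andP[v]; case: o => [x|_] /=.
  case/and3P=> _ _ pl; rewrite restrict_tab //.
  exact/covers_insert/tableau_tab.
case: ifP => pl; last by rewrite restrict_tab ?pl.
apply: covers_restrict; rewrite ?uniq_tab ?below_tab //.
  exact: tableau_tab.
by rewrite mem_tab // ltnSn.
Qed.

Lemma shape_path_shapes p es : valid p es ->
  shape_path (shape (tab p es)) (shapes p es).
Proof.
elim: es p => // o es IHes p v; split; first exact/part_shape/tableau_tab.
have := covers_step v; have /andP[v' _] := v; split; last exact: IHes.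
by case: o {v} H => [x|] /=; [|case: ifP => _]; constructor.
Qed.

Lemma shape_path_conj a L : shape_path a L ->
  shape_path (conj_part a) (map conj_part L).
Proof.
elim: L a => [|b L IHL] a /= [pa h]; split; try exact: part_conj.
  by rewrite h.
case: h => h sp; split; last exact: IHL.
have pb : is_part b by case: (L) sp => [|? ?] [].
by case: h => [->|c|c]; constructor => //; apply: covers_conj.
Qed.

(** The walk is undone from left to right: a growing step puts the current
    position into the new cell, a shrinking step pops a letter out of the
    tableau by reverse insertion and so chooses the opener that is closed. *)
Lemma decode L p T : tableau T -> all (gtn p) (flatten T) -> uniq (flatten T) ->
  shape_path (shape T) L ->
  exists es, [/\ valid p es, tab p es = T & shapes p es = L].
Proof.
elim: L p T => [|b L IHL] p T tT hT uT /= [pT].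
  by case: T {tT hT uT pT} => // _; exists [::].
have hS (s : seq nat) : all (gtn p) s -> all (gtn p.+1) s.
  by apply: sub_all => a /=; lia.
case=> step sp; have pb : is_part b by case: (L) sp => [|? ?] [].
case: step => [e|c|c].
- rewrite -e in sp; have [es [v et <-]] := IHL p.+1 T tT (hS _ hT) uT sp.
  by exists (None :: es); rewrite /= v et restrict_id // e.
- have [T' [tT' shT' rT' pT']] := tableau_grow tT hT pb c.
  have hT' : all (gtn p.+1) (flatten T').
    by rewrite (perm_all _ pT') /= ltnSn hS.
  have uT' : uniq (flatten T').
    rewrite (perm_uniq pT') /= uT andbT; apply/negP => /(allP hT) /=.
    by rewrite ltnn.
  rewrite -shT' in sp *; have [es [v et <-]] := IHL p.+1 T' tT' hT' uT' sp.
  by exists (None :: es); rewrite /= v et rT'.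
have [x [T' [tT' shT' iT']]] := insert_surj tT pb c.
have pT' : perm_eq (flatten T) (x :: flatten T') by rewrite -iT' perm_insert.
move: (hT) (uT); rewrite (perm_all _ pT') (perm_uniq pT') /=.
move=> /andP[xp hT'] /andP[xT' uT'].
rewrite -shT' in sp *.
have [es [v et <-]] := IHL p.+1 T' tT' (hS _ hT') uT' sp.
exists (Some x :: es); rewrite /= v xp et restrict_id // iT'; split=> //.
have nl y : y < p.+1 -> y \notin flatten T' -> y \notin letters es.
  by move=> yp; rewrite -et mem_tab // yp.
rewrite !nl //; last exact: leqW.
by apply/negP => /(allP hT') /=; rewrite ltnn.
Qed.

Lemma covers_asym l m : covers l m -> covers m l -> False.
Proof. by move=> [i hi] [j hj]; have := hi i; have := hj i; lia. Qed.

Lemma covers_irr l : covers l l -> False.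
Proof. by move=> h; exact: (covers_asym h h). Qed.

(** The kind of each event is visible on the shapes, and each kind of step is
    injective when the shape of the other tableau is known. *)
Lemma shapes_inj p es1 es2 : valid p es1 -> valid p es2 ->
  tab p es1 = tab p es2 -> shapes p es1 = shapes p es2 -> es1 = es2.
Proof.
elim: es1 p es2 => [|o1 es1 IHes] p [|o2 es2] //.
move=> v1 v2 et [esh eshs]; have := covers_step v1; have := covers_step v2; cbv zeta.
rewrite -et esh; move: (v1) (v2) => /= /andP[v1' h1] /andP[v2' h2].
have b1 := below_tab v1'; have b2 := below_tab v2'.
have t1 := tableau_tab p.+1 es1; have t2 := tableau_tab p.+1 es2.
case: o1 o2 h1 h2 et {v1 v2} => [x1|] [x2|] /= h1 h2 et.
- case/and3P: h1 => _ _ n1; case/and3P: h2 => _ _ n2 _ _.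
  move: et; rewrite !restrict_tab // => et.
  have [-> eT] := insert_inj t1 t2 esh et.
  by rewrite (IHes _ _ v1' v2' eT eshs).
- case: ifP => _ c1 c2; first by case: (covers_asym c1 c2).
  by rewrite c1 in c2; case: (covers_irr c2).
- move=> c2; case: ifP => _ c1; first by case: (covers_asym c1 c2).
  by rewrite c1 in c2; case: (covers_irr c2).
move=> _ _; have eT := restrict_inj t1 t2 b1 b2 esh et.
by rewrite (IHes _ _ v1' v2' eT eshs).
Qed.

(** Transposition preserves growing and shrinking steps, which are exactly
    the openers and the closers. *)
Lemma conj_profile p es1 es2 : valid p es1 -> valid p es2 ->
  shape (tab p es2) = conj_part (shape (tab p es1)) ->
  shapes p es2 = map conj_part (shapes p es1) ->
  map isSome es1 = map isSome es2 /\
  forall x, p <= x -> (x \in letters es1) = (x \in letters es2).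
Proof.
elim: es1 p es2 => [|o1 es1 IHes] p [|o2 es2] //.
move=> v1 v2 et [esh eshs]; have := covers_step v1; have := covers_step v2; cbv zeta.
rewrite /= -/(tab p (o1 :: es1)) -/(tab p (o2 :: es2)) et esh.
have p1 := part_shape (tableau_tab p (o1 :: es1)).
have p2 := part_shape (tableau_tab p.+1 es1).
move: (v1) (v2) => /= /andP[v1' h1] /andP[v2' h2].
have [eS el] := IHes _ _ v1' v2' esh eshs; rewrite eS.
have cc := covers_conj p1 p2; have cc' := covers_conj p2 p1.
have ext x : p <= x -> p < x \/ x = p by lia.
have out y1 (es : seq _) : y1 < p -> forall x, p <= x ->
    (x \in letters (Some y1 :: es)) = (x \in letters es).
  by move=> yp x px; rewrite /letters /= inE; case: eqP => // e; lia.
case: o1 o2 h1 h2 cc cc' p1 {v1 v2 et} => [x1|] [x2|] /= h1 h2 cc cc' p1.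
- case/and3P: h1 => x1p _ n1; case/and3P: h2 => x2p _ n2 _ _; split=> // x px.
  rewrite !out //; case: (ext x px) => [|->]; first exact: el.
  by rewrite (negPf n1) (negPf n2).
- case: ifP => _ c1 /cc' c2; first by case: (covers_asym c1 c2).
  by rewrite c1 in c2; case: (covers_irr c2).
- move=> c2; case: ifP => _ c1; first by case: (covers_asym (cc c1) c2).
  by rewrite c1 in c2; case: (covers_irr c2).
move=> c2 c1; split=> // x px; case: (ext x px) => [|->]; first exact: el.
move: c1 c2; case: ifP => l1; case: ifP => l2 //.
- by move=> /cc c1 c2; rewrite c2 in c1; case: (covers_irr c1).
- by move=> -> /covers_irr.
Qed.

(** * Knuth equivalence and Schensted's theorem *)

(** Of two equal letters the left one counts as the larger, in accordance with
    [row_insert]; hence the one weak inequality in each relation. *)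
Inductive knuth : seq nat -> seq nat -> Prop :=
| knuth_refl u : knuth u u
| knuth_sym u v : knuth u v -> knuth v u
| knuth_trans u v w : knuth u v -> knuth v w -> knuth u w
| knuth_xzy a b x y z : x < y -> y <= z ->
    knuth (a ++ [:: x; z; y] ++ b) (a ++ [:: z; x; y] ++ b)
| knuth_yxz a b x y z : x <= y -> y < z ->
    knuth (a ++ [:: y; x; z] ++ b) (a ++ [:: y; z; x] ++ b).

Lemma knuth_cat a b u v : knuth u v -> knuth (a ++ u ++ b) (a ++ v ++ b).
Proof.
elim=> {u v} [u|u v _|u v w _ h _|c d x y z xy yz|c d x y z xy yz].
- exact: knuth_refl.
- exact: knuth_sym.
- exact: knuth_trans.
- by rewrite -!(catA c) -!catA !(catA a c); apply: knuth_xzy.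
- by rewrite -!(catA c) -!catA !(catA a c); apply: knuth_yxz.
Qed.

Lemma knuth_cons a u v : knuth u v -> knuth (a :: u) (a :: v).
Proof. by move=> /(knuth_cat [:: a] [::]); rewrite !cats0. Qed.

(** If a letter of an elementary relation is dropped then so is [z], the
    largest of the three, and without it both sides agree. *)
Lemma knuth_keep_below p u v : knuth u v ->
  knuth (keep_below p u) (keep_below p v).
Proof.
elim=> {u v} [u|u v _|u v w _ h _|a b x y z xy yz|a b x y z xy yz].
- exact: knuth_refl.
- exact: knuth_sym.
- exact: knuth_trans.
- rewrite /keep_below !filter_cat /=; case: (ltnP z p) => zp; last first.
    exact: knuth_refl.
  have -> : x < p by lia.
  have -> : y < p by lia.
  exact: knuth_xzy.
rewrite /keep_below !filter_cat /=; case: (ltnP z p) => zp; last first.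
  exact: knuth_refl.
have -> : x < p by lia.
have -> : y < p by lia.
exact: knuth_yxz.
Qed.

Fixpoint reading (T : seq (seq nat)) : seq nat :=
  if T is r :: T' then reading T' ++ r else [::].

(** The inserted letter travels left along the entries larger than the one it
    bumps; in [knuth_row_insert] the bumped letter then travels to the front
    along the smaller entries. *)
Lemma knuth_slide x y r : sorted ltn (y :: r) -> x <= y ->
  knuth (rcons (y :: r) x) (y :: x :: r).
Proof.
elim: r y => [|z r IHr] y; first by move=> *; apply: knuth_refl.
rewrite sorted_cons => /andP[/allP al sr] xy; have /= yz := al z (mem_head _ _).
apply: (@knuth_trans _ (y :: z :: x :: r)).
  by apply/knuth_cons/IHr => //; lia.
exact/knuth_sym/(@knuth_yxz [::] r x y z xy yz).
Qed.

Lemma knuth_row_insert x r r' y : sorted ltn r ->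
  row_insert x r = (r', Some y) -> knuth (rcons r x) (y :: r').
Proof.
elim: r r' => //= z r IHr r' sr; case: leqP => [xz [<- <-]|zx].
  exact: knuth_slide.
move: (sr); rewrite sorted_cons => /andP[/allP al s1].
case e: (row_insert x r) => [s o] [<- eo]; rewrite eo in e.
apply: knuth_trans (knuth_cons z (IHr _ s1 e)) _.
have [[ss _ hs] [xy yr xs] _ _] := row_insert_bump s1 e.
have /perm_mem hm := perm_row_insert e.
case: s ss hs xs e hm => // a s ss /= ax _ _ hm.
apply: (@knuth_xzy [::] s z a y); last by lia.
have : a \in y :: a :: s by rewrite !inE eqxx orbT.
by rewrite hm inE => /orP[/eqP -> //|/al].
Qed.

Lemma knuth_insert x T : tableau T ->
  knuth (rcons (reading T) x) (reading (insert x T)).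
Proof.
elim: T x => [|r T IHT] x; first by move=> _; apply: knuth_refl.
move=> [_ sr _ tT] /=; case e: (row_insert x r) => [r' [y|]] /=; last first.
  by have [-> _] := row_insert_end sr e; rewrite rcons_cat; apply: knuth_refl.
rewrite rcons_cat; apply: (@knuth_trans _ (reading T ++ y :: r')).
  by have := knuth_cat (reading T) [::] (knuth_row_insert sr e); rewrite !cats0.
by rewrite -cat_rcons; apply: (@knuth_cat [::]); apply: IHT.
Qed.

Lemma reading_restrict p T : tableau T ->
  reading (restrict p T) = keep_below p (reading T).
Proof.
elim: T => // r T IHT tT; have [r0 sr d tT'] := tT.
case: (eqVneq (keep_below p r) [::]) => h.
  rewrite restrict_cons0 //; apply/esym/size0nil/eqP.
  have /perm_filter/perm_size pf : perm_eq (reading (r :: T)) (flatten (r :: T)).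
    apply/seq.permP => P; elim: (r :: T) => //= s U IHU.
    by rewrite !count_cat IHU addnC.
  rewrite pf -/(keep_below _ _) keep_below_flatten0 //=.
  by rewrite /below -size_filter -/(keep_below p r) h.
by rewrite restrict_cons //= IHT // /keep_below filter_cat.
Qed.

(** The tableau at [p] stands for the openers, left of [p], of the arcs closed
    at [p] or later, the latest closer first. *)
Lemma knuth_tab p es : valid p es ->
  knuth (keep_below p (rev (letters es))) (reading (tab p es)).
Proof.
elim: es p => [|o es IHes] p /=; first by move=> _; apply: knuth_refl.
move=> /andP[v ho]; have tT := tableau_tab p.+1 es.
have h : knuth (keep_below p (rev (letters es)))
    (reading (restrict p (tab p.+1 es))).
  rewrite reading_restrict //; have := knuth_keep_below p (IHes _ v).
  suff -> : keep_below p (keep_below p.+1 (rev (letters es))) =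
      keep_below p (rev (letters es)) by [].
  by rewrite /keep_below -filter_predI; apply: eq_filter => a /=; lia.
case: o ho => [x /and3P[xp _ _]|_] //.
apply: knuth_trans (knuth_insert x (tableau_restrict p tT)).
rewrite /letters /= rev_cons /keep_below filter_rcons xp -!cats1.
exact: (@knuth_cat [::]).
Qed.

Definition has_chain (e : rel nat) k u :=
  exists s, [/\ subseq s u, pairwise e s & size s = k].

Lemma subseq_catE (T : eqType) (s u v : seq T) : subseq s (u ++ v) ->
  exists s1 s2, [/\ s = s1 ++ s2, subseq s1 u & subseq s2 v].
Proof.
move=> /subseqP[m sz ->]; exists (mask (take (size u) m) u).
exists (mask (drop (size u) m) v); rewrite !mask_subseq -mask_cat ?cat_take_drop //.
by rewrite size_takel // sz size_cat leq_addr.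
Qed.

(** A chain in [a ++ m ++ b] is repaired inside [m] alone, provided that its
    replacement there is bounded by whatever bounded the original part. *)
Lemma has_chain_replace e k a b m m' :
  (forall s, subseq s m -> pairwise e s -> exists s',
     [/\ subseq s' m', pairwise e s', size s' = size s,
         forall w, all (e w) s -> all (e w) s'
       & forall w, all (e^~ w) s -> all (e^~ w) s']) ->
  has_chain e k (a ++ m ++ b) -> has_chain e k (a ++ m' ++ b).
Proof.
move=> hm [s [/subseq_catE[s1 [s23 [-> h1 /subseq_catE[s2 [s3 [-> h2 h3]]]]]]]].
rewrite !pairwise_cat allrel_catr => /and3P[/andP[r12 r13] p1 /and3P[r23 p2 p3]].
have [s2' [h2' p2' sz hl hr]] := hm s2 h2 p2 => sk.
exists (s1 ++ s2' ++ s3); rewrite !cat_subseq // -sk !size_cat sz.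
rewrite !pairwise_cat allrel_catr r13 p1 p2' p3 /= !andbT; split=> //.
apply/andP; split; first by apply: sub_all r12 => w; apply: hl.
move: r23; rewrite !(allrelC _ _ s3); apply: sub_all => w; exact: hr.
Qed.

Lemma subseq3 (s : seq nat) x y z : subseq s [:: x; y; z] ->
  exists b1 b2 b3, s = mask [:: b1; b2; b3] [:: x; y; z].
Proof.
by move=> /subseqP[[|b1 [|b2 [|b3 [|? ?]]]] // _ ->]; exists b1, b2, b3.
Qed.

(** A chain that uses both letters that are exchanged, [x] and [z], avoids
    [y]; replacing one of them by its neighbour [y] gives a chain of the same
    length after the exchange. All other chains survive as they are. *)
Lemma knuth_chain e k u v : e = ltn \/ e = geq -> knuth u v ->
  has_chain e k u <-> has_chain e k v.
Proof.
move=> he.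
elim=> {u v} [u|u v _ -> //|u v w _ -> _ -> //|a b x y z xy yz|a b x y z xy yz] //.
- split; apply: has_chain_replace => s /subseq3[b1 [b2 [b3 ->]]] ps.
  (* The first branch of each mask replaces a pair [x], [z] by one with [y]. *)
  + exists (mask (if b1 && b2 then [:: false; true; true] else [:: b2; b1; b3])
             [:: z; x; y]).
    move: ps; rewrite mask_subseq; case: he => ->; case: b1 b2 b3 => -[] [] /= ps;
    by split=> //= *; lia.
  + exists (mask (if b1 && b2 then [:: false; true; true] else [:: b2; b1; b3])
             [:: x; z; y]).
    move: ps; rewrite mask_subseq; case: he => ->; case: b1 b2 b3 => -[] [] /= ps;
    by split=> //= *; lia.
- split; apply: has_chain_replace => s /subseq3[b1 [b2 [b3 ->]]] ps.
  + exists (mask (if b2 && b3 then [:: true; true; false] else [:: b1; b3; b2])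
             [:: y; z; x]).
    move: ps; rewrite mask_subseq; case: he => ->; case: b1 b2 b3 => -[] [] /= ps;
    by split=> //= *; lia.
  + exists (mask (if b2 && b3 then [:: true; true; false] else [:: b1; b3; b2])
             [:: y; x; z]).
    move: ps; rewrite mask_subseq; case: he => ->; case: b1 b2 b3 => -[] [] /= ps;
    by split=> //= *; lia.
Qed.

Lemma chain_sub_row k (r : seq nat) : sorted ltn r -> k <= size r ->
  exists s, [/\ subseq s r, pairwise ltn s & size s = k].
Proof.
move=> sr kr; exists (take k r); rewrite take_subseq size_takel //; split=> //.
rewrite -(sorted_pairwise ltn_trans).
exact: (subseq_sorted ltn_trans (take_subseq _ _) sr).
Qed.

(** An increasing subword of the reading word uses at most one letter of each
    column. The induction bounds a subword with letters below [v] by the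
    number of columns whose top entry is below [v]. *)
Lemma increasing_le v s T : tableau T -> subseq s (reading T) ->
  pairwise ltn s -> all (gtn v) s -> size s <= below v (head [::] T).
Proof.
elim: T s v => [|r T IHT] s v; first by move=> _ /eqP ->.
move=> [r0 sr d tT] /= /subseq_catE[s1 [s2 [-> h1 h2]]].
rewrite pairwise_cat all_cat => /and3P[r12 p1 p2] /andP[a1 a2].
case: s2 h2 r12 p2 a2 => [|a s2] h2 r12 p2 a2.
  by rewrite cats0; apply: leq_trans (IHT _ _ tT h1 p1 a1) (d v).
have a1' : all (gtn a) s1.
  by apply: sub_all r12 => w /= /andP[].
have := leq_trans (IHT _ _ tT h1 p1 a1') (d a); rewrite size_cat.
move=> le1; apply: leq_trans (_ : below a r + size (a :: s2) <= _).
  by rewrite leq_add2r.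
have av : a < v by case/andP: a2.
have ps : perm_eq r (keep_below a r ++ [seq b <- r | ~~ (b < a)]).
  by rewrite perm_sym; apply/permPl/perm_filterC.
rewrite {2}/below (seq.permP ps) count_cat.
apply: leq_add.
  by rewrite -/(below v _) below_keep (minn_idPr (ltnW av)).
have sub : subseq (a :: s2) [seq b <- r | ~~ (b < a)].
  have <- : [seq b <- a :: s2 | ~~ (b < a)] = a :: s2.
    apply/all_filterP; rewrite /= ltnn /=.
    by case/andP: p2 => h _; apply: sub_all h => w /=; lia.
  by rewrite subseq_filter (subseq_trans (filter_subseq _ _) h2) andbT filter_all.
apply: leq_trans (_ : below v (a :: s2) <= _); first by rewrite below_all.
exact: leq_count_subseq.
Qed.

(** A decreasing subword uses at most one letter of each increasing row. *)
Lemma decreasing_le s T : tableau T -> subseq s (reading T) ->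
  pairwise geq s -> size s <= size T.
Proof.
elim: T s => [|r T IHT] s; first by move=> _ /eqP ->.
move=> [r0 sr d tT] /= /subseq_catE[s1 [s2 [-> h1 h2]]].
rewrite pairwise_cat size_cat => /and3P[_ p1 p2].
have := IHT _ tT h1 p1; have := subseq_sorted ltn_trans h2 sr.
by case: s2 p2 {h2} => [|a [|b s2]] /=; lia.
Qed.

Lemma first_column T : tableau T ->
  exists s, [/\ subseq s (reading T), pairwise geq s, size s = size T
              & all (leq (head 0 (head [::] T))) s].
Proof.
elim: T => [|r T IHT]; first by exists [::].
move=> [r0 sr d tT]; have [s [h1 h2 h3 h4]] := IHT tT.
have hle : all (leq (head 0 r)) s.
  case: (eqVneq (head [::] T) [::]) => h.
    by case: T tT h h3 {IHT d h1 h4} => [|u T] /=; [case: (s)|move=> [/eqP]].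
  have [_ hh] := head_dominates sr d h; apply: sub_all h4 => a /=; exact: leq_trans.
exists (rcons s (head 0 r)); split=> /=; last 1 first.
- by rewrite all_rcons leqnn.
- rewrite -cats1; apply: cat_subseq h1 _; rewrite sub1seq -nth0 mem_nth //.
  by case: (r) r0.
- by rewrite pairwise_rcons h2 andbT; apply: sub_all hle => a.
- by rewrite size_rcons h3.
Qed.

Lemma increasing_tableau k T : tableau T ->
  has_chain ltn k (reading T) <-> k <= head 0 (shape T).
Proof.
move=> tT; split=> [[s [ss ps <-]]|].
  pose v := (\max_(a <- s) a).+1.
  have hv : all (gtn v) s by apply/allP => a ha /=; rewrite ltnS leq_bigmax_seq.
  apply: leq_trans (increasing_le tT ss ps hv) _.
  by case: (T) => //= r ?; exact: below_size.
case: T tT => [|r T]; first by rewrite leqn0 => _ /eqP ->; exists [::].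
move=> [_ sr _ _] /= kr; have [s [h1 h2 h3]] := chain_sub_row sr kr.
exists s; split=> //=; exact: subseq_trans h1 (suffix_subseq _ _).
Qed.

Lemma decreasing_tableau k T : tableau T ->
  has_chain geq k (reading T) <-> k <= size (shape T).
Proof.
move=> tT; rewrite size_map; split=> [[s [ss ps <-]]|kT].
  exact: decreasing_le.
have [s [h1 h2 h3 _]] := first_column tT.
exists (take k s); rewrite size_takel ?h3 //; split=> //.
  exact: subseq_trans (take_subseq _ _) h1.
exact: (subseq_pairwise (take_subseq _ _) h2).
Qed.

(** * Chains of transposed matchings *)

(** The openers, left of [p], of the arcs closed at [p] or later, the latest
    closer first. *)
Definition word p es := keep_below p (rev (letters (drop p es))).

Lemma tab0 es : valid 0 es -> tab 0 es = [::].
Proof.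
move=> v; have := below_tab v; have := tableau_tab 0 es.
by case: (tab 0 es) => // -[|a r] T [].
Qed.

Lemma nth_shapes p i es :
  nth [::] (shape (tab p es) :: shapes p es) i = shape (tab (p + i) (drop i es)).
Proof.
elim: es p i => [|o es IHes] p [|i]; rewrite ?addn0 ?drop0 //.
  by rewrite nth_default.
by rewrite -addSnnS -IHes.
Qed.

Lemma part_shapes p es : all is_part (shapes p es).
Proof.
by elim: es p => //= o es IHes p; rewrite IHes andbT; apply/part_shape/tableau_tab.
Qed.

Lemma valid_drop p i es : valid p es -> valid (p + i) (drop i es).
Proof.
elim: es p i => [|o es IHes] p [|i] //; rewrite ?addn0 //.
by move=> /andP[v _]; rewrite -addSnnS; apply: IHes.
Qed.

Lemma conj_events es : valid 0 es -> exists es',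
  valid 0 es' /\ shapes 0 es' = map conj_part (shapes 0 es).
Proof.
move=> v; have := shape_path_conj (shape_path_shapes v); rewrite tab0 // => sp.
by have [es' [v' _ e]] := @decode _ 0 [::] I isT isT sp; exists es'.
Qed.

Lemma shape_conj es es' p : valid 0 es -> valid 0 es' ->
  shapes 0 es' = map conj_part (shapes 0 es) ->
  shape (tab p (drop p es')) = conj_part (shape (tab p (drop p es))).
Proof.
move=> v v' e; have := nth_shapes 0 p es; have := nth_shapes 0 p es'.
rewrite !tab0 // e !add0n => <- <-.
case: p => //= p; case: (ltnP p (size (shapes 0 es))) => h.
  by rewrite (nth_map [::]).
by rewrite !nth_default ?size_map.
Qed.

Lemma increasing_word es p k : valid 0 es ->
  has_chain ltn k (word p es) <-> k <= head 0 (shape (tab p (drop p es))).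
Proof.
move=> v; have v' := valid_drop p v; have kn := knuth_tab v'.
have := knuth_chain k (or_introl (erefl ltn)) kn.
by have := increasing_tableau k (tableau_tab p (drop p es)); rewrite /word; tauto.
Qed.

Lemma decreasing_word es p k : valid 0 es ->
  has_chain geq k (word p es) <-> k <= size (shape (tab p (drop p es))).
Proof.
move=> v; have v' := valid_drop p v; have kn := knuth_tab v'.
have := knuth_chain k (or_intror (erefl geq)) kn.
by have := decreasing_tableau k (tableau_tab p (drop p es)); rewrite /word; tauto.
Qed.

Lemma conj_chain es es' p k : valid 0 es -> valid 0 es' ->
  shapes 0 es' = map conj_part (shapes 0 es) ->
  (has_chain ltn k (word p es') <-> has_chain geq k (word p es)) /\
  (has_chain geq k (word p es') <-> has_chain ltn k (word p es)).
Proof.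
move=> v v' e; have pt := part_shape (tableau_tab p (drop p es)).
have := increasing_word p k v; have := increasing_word p k v'.
have := decreasing_word p k v; have := decreasing_word p k v'.
rewrite (shape_conj p v v' e) head_conj // size_conj; tauto.
Qed.

Lemma mem_letters x es : (x \in letters es) = (Some x \in es).
Proof. by rewrite /letters mem_pmap map_id. Qed.

Lemma nth_letters x es :
  x \in letters es <-> exists i, nth None es i = Some x.
Proof.
rewrite mem_letters; split=> [/(nthP None)[i _ e]|[i e]]; first by exists i.
rewrite -e mem_nth // ltnNge; apply/negP => h.
by rewrite nth_default in e.
Qed.

Lemma validP p es : valid p es <-> forall i x, nth None es i = Some x ->
  [/\ x < p + i, forall j, i < j -> nth None es j <> Some x
    & forall j, i < j -> nth None es j <> Some (p + i)].
Proof.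
elim: es p => [|o es IHes] p; first by split=> // _ i x; rewrite nth_nil.
split=> [/andP[/IHes v ho] [|i] x /=|h].
- move=> e; rewrite e in ho; case/and3P: ho => xp xl pl; rewrite addn0.
  split=> // -[|j] // _ /= ej; first by case/negP: xl; apply/nth_letters; exists j.
  by case/negP: pl; apply/nth_letters; exists j.
- move=> /v[h1 h2 h3]; rewrite -addSnnS; split=> // -[|j] // ij /=.
    exact: h2.
  exact: h3.
apply/andP; split.
  apply/IHes => i x e; have [] := h i.+1 x e; rewrite addSnnS => h1 h2 h3.
  by split=> // j ij; [apply: (h2 j.+1)|apply: (h3 j.+1)].
case: o h => // x h; have [/=] := h 0 x erefl; rewrite addn0 => -> h2 h3 /=.
apply/andP; split; apply/negP => /(iffLR (nth_letters _ _))[j e].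
  exact: (h2 j.+1).
exact: (h3 j.+1).
Qed.

Lemma valid_letter_inj p es i j x : valid p es ->
  nth None es i = Some x -> nth None es j = Some x -> i = j.
Proof.
move=> /validP v ei ej; have [_ hi _] := v _ _ ei; have [_ hj _] := v _ _ ej.
by case: (ltngtP i j) => // [/hi|/hj].
Qed.

(** * Events of a permutation *)

Lemma gtn_trans : transitive gtn.
Proof. by move=> a b c /= h1 h2; apply: ltn_trans h2 h1. Qed.

Section Events.
Variables (n : nat).
Implicit Types (S : {perm 'I_n}) (K : pred 'I_n) (u : bool).

(** Every arc from [i] to [S i] closes at [i] and opens at [S i]. Upper arcs
    have [i] on the left, so their diagram is reflected. Each vertex is doubled
    so that opening and closing ends get distinct positions: for upper arcs,
    where [i <= S i] includes loops and enhanced patterns, a vertex opens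
    before it closes; for lower arcs it closes before it opens. Both kinds of
    patterns then become strict ones. *)
Definition cpos u (i : 'I_n) := if u then 2 * (n.-1 - i) + 1 else 2 * i.
Definition opos u (i : 'I_n) := if u then 2 * (n.-1 - i) else 2 * i + 1.

Definition closing u K q := [pick i | K i && (cpos u i == q)].

Definition events u K S : seq (option nat) :=
  mkseq (fun q => omap (fun i => opos u (S i)) (closing u K q)) (2 * n).

Lemma cpos_inj u : injective (cpos u).
Proof.
move=> i j; have := ltn_ord i; have := ltn_ord j; rewrite /cpos => hi hj e.
by apply: val_inj; case: u e => /=; lia.
Qed.

Lemma opos_inj u : injective (opos u).
Proof.
move=> i j; have := ltn_ord i; have := ltn_ord j; rewrite /opos => hi hj e.
by apply: val_inj; case: u e => /=; lia.
Qed.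

Lemma cpos_opos u i j : cpos u i <> opos u j.
Proof. by rewrite /cpos /opos; case: u; lia. Qed.

Lemma cpos_lt u i : cpos u i < 2 * n.
Proof. by have := ltn_ord i; rewrite /cpos; case: u; lia. Qed.

Lemma opos_lt_cpos u (i j : 'I_n) :
  (opos u j < cpos u i) = if u then i <= j else j < i.
Proof.
by have := ltn_ord i; have := ltn_ord j; rewrite /cpos /opos; case: u; lia.
Qed.

Lemma cpos_lt_mono u (i j : 'I_n) :
  (cpos u i < cpos u j) = if u then j < i else i < j.
Proof. by have := ltn_ord i; have := ltn_ord j; rewrite /cpos; case: u; lia. Qed.

Lemma opos_lt_mono u (i j : 'I_n) :
  (opos u i < opos u j) = if u then j < i else i < j.
Proof. by have := ltn_ord i; have := ltn_ord j; rewrite /opos; case: u; lia. Qed.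

Lemma closing_cpos u K i : K i -> closing u K (cpos u i) = Some i.
Proof.
move=> Ki; rewrite /closing; case: pickP => [j /andP[_ /eqP/cpos_inj->] //|].
by move/(_ i); rewrite Ki eqxx.
Qed.

Lemma closingP u K q i : closing u K q = Some i -> K i /\ cpos u i = q.
Proof. by rewrite /closing; case: pickP => // j /andP[Kj /eqP e] [<-]. Qed.

Lemma nth_events u K S i : K i ->
  nth None (events u K S) (cpos u i) = Some (opos u (S i)).
Proof. by move=> Ki; rewrite nth_mkseq ?cpos_lt // closing_cpos. Qed.

Lemma nth_eventsP u K S q x : nth None (events u K S) q = Some x ->
  exists i, [/\ K i, cpos u i = q & x = opos u (S i)].
Proof.
case: (ltnP q (2 * n)) => hq; last by rewrite nth_default ?size_mkseq.
rewrite nth_mkseq //; case e: closing => [i|] //= [<-].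
by have [Ki ci] := closingP e; exists i.
Qed.

Lemma valid_events u K S : (forall i, K i -> opos u (S i) < cpos u i) ->
  valid 0 (events u K S).
Proof.
move=> hK; apply/validP => q x /nth_eventsP[i [Ki <- ->]]; rewrite add0n.
split=> [|j ij /nth_eventsP[i' [_ e /opos_inj/perm_inj ei]]
         |j ij /nth_eventsP[i' [_ _ /cpos_opos]] //]; first exact: hK.
by move: ij; rewrite -e ei ltnn.
Qed.

Lemma letters_events u K S x :
  x \in letters (events u K S) <-> exists2 i, K i & x = opos u (S i).
Proof.
rewrite nth_letters; split=> [[q /nth_eventsP[i [Ki _ ->]]]|[i Ki ->]].
  by exists i.
by exists (cpos u i); apply: nth_events.
Qed.

(** Arcs listed by decreasing closer, all spanning a common position: a
    crossing if the openers decrease ([e] is [geq]), a nesting if they increase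
    ([e] is [ltn]). *)
Definition mono_chain (e : rel nat) u K S k := exists s : seq 'I_n,
  [/\ size s = k, all K s, pairwise (fun i j => cpos u j < cpos u i) s,
      pairwise (fun i j => e (opos u (S i)) (opos u (S j))) s
    & {in s &, forall i j, opos u (S i) < cpos u j}].

Lemma word_events u K S p : word p (events u K S) =
  [seq opos u (S i) | i <- pmap (closing u K) (rev (iota p (2 * n - p)))
                    & opos u (S i) < p].
Proof.
rewrite /word /keep_below.
suff -> : rev (letters (drop p (events u K S))) = [seq opos u (S i) |
    i <- pmap (closing u K) (rev (iota p (2 * n - p)))] by rewrite filter_map.
rewrite /events /mkseq -map_drop drop_iota add0n /letters.
elim: (iota p _) => //= q l IHl; rewrite rev_cons.
rewrite -cats1 pmap_cat map_cat -IHl /=.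
by case: closing => [i|] /=; rewrite ?rev_cons ?cats1 ?cats0.
Qed.

Lemma closing_sorted u K l : pairwise gtn l ->
  pairwise (fun i j => cpos u j < cpos u i) (pmap (closing u K) l).
Proof.
elim: l => //= q l IHl /andP[al /IHl h].
case e: closing => [i|] //=; rewrite h andbT.
have [_ ci] := closingP e; apply/allP => j.
rewrite mem_pmap => /mapP[q' /(allP al) /= hq /esym/closingP[_ cj]].
by rewrite ci cj.
Qed.

Lemma mem_closing u K l i : (i \in pmap (closing u K) l) = K i && (cpos u i \in l).
Proof.
rewrite mem_pmap; apply/mapP/andP => [[q ql /esym/closingP[Ki e]]|[Ki cl]].
  by rewrite e.
by exists (cpos u i); rewrite ?closing_cpos.
Qed.

(** The common position can be taken just after the largest opener. *)
Lemma mono_chainP e u K S k :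
  mono_chain e u K S k <-> exists p, has_chain e k (word p (events u K S)).
Proof.
split=> [[s [sz Ks ps es sep]]|[p [t [st pt sz]]]].
  pose p := (\max_(i <- s) opos u (S i)).+1; exists p.
  exists [seq opos u (S i) | i <- s]; rewrite size_map pairwise_map; split=> //.
  rewrite word_events; apply: map_subseq; set V := filter _ _.
  have ltr : transitive (fun i j : 'I_n => cpos u j < cpos u i).
    by move=> j i l /= h1 h2; apply: ltn_trans h2 h1.
  have pV : pairwise (fun i j => cpos u j < cpos u i) V.
    apply: subseq_pairwise (filter_subseq _ _) _; apply: closing_sorted.
    rewrite -(sorted_pairwise gtn_trans) rev_sorted.
    exact: iota_ltn_sorted.
  suff -> : s = [seq i <- V | i \in s] by apply: filter_subseq.
  apply: (@irr_sorted_eq _ (fun i j => cpos u j < cpos u i)) => //.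
  - by move=> i; rewrite ltnn.
  - by rewrite sorted_pairwise.
  - by rewrite sorted_pairwise // (subseq_pairwise (filter_subseq _ _) pV).
  move=> i; rewrite mem_filter; case is_ : (i \in s) => //=.
  rewrite mem_filter ltnS (leq_bigmax_seq (F := fun i => opos u (S i))) //=.
  rewrite mem_closing (allP Ks _ is_) mem_rev mem_iota /=.
  have pc : p <= cpos u i.
    rewrite /p big_seq; apply: (big_ind (fun m => m < cpos u i)) => [|a b|j js].
    - exact: leq_ltn_trans (leq0n _) (sep i i is_ is_).
    - by rewrite gtn_max => -> ->.
    - exact: sep.
  rewrite pc /=; have := cpos_lt u i; lia.
move: st; rewrite word_events => /subseqP[m szm et].
rewrite -map_mask in et.
set V := filter _ _ in szm et.
exists (mask m V); have sV : subseq (mask m V) V by exact: mask_subseq.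
have hV i : i \in mask m V -> [/\ K i, p <= cpos u i & opos u (S i) < p].
  move=> /(mem_subseq sV); rewrite mem_filter mem_closing mem_rev mem_iota.
  by move=> /and3P[h1 h2 /andP[h3 _]].
split.
- by rewrite -sz et size_map.
- by apply/allP => i /hV[].
- apply: subseq_pairwise sV _; apply: subseq_pairwise (filter_subseq _ _) _.
  apply: closing_sorted; rewrite -(sorted_pairwise gtn_trans) rev_sorted.
  exact: iota_ltn_sorted.
- by move: pt; rewrite et pairwise_map.
- by move=> i j /hV[_ _ h1] /hV[_ h2 _]; apply: leq_trans h1 h2.
Qed.
End Events.

(** * Coloured permutations *)

(** The vertex [i] of which the arc is [arc_from S i]. *)
Definition source n (a : arc n) : 'I_n := if upper a then a.1.2 else a.2.

Lemma source_arc n (S : {perm 'I_n}) i : source (arc_from S i) = i.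
Proof. by rewrite /source /arc_from; case: (_ <= _). Qed.

Lemma arc_source n (S : {perm 'I_n}) a : a \in Arc S -> arc_from S (source a) = a.
Proof. by case/imsetP => i _ ->; rewrite source_arc. Qed.

Lemma upper_arc n (S : {perm 'I_n}) i : upper (arc_from S i) = (i <= S i).
Proof. by rewrite /arc_from; case: (_ <= _). Qed.

Lemma mem_Arc n (S : {perm 'I_n}) i : arc_from S i \in Arc S.
Proof. exact: imset_f. Qed.

Definition arc_of n (S : {perm 'I_n}) i : {a : arc n | a \in Arc S} :=
  exist _ (arc_from S i) (mem_Arc S i).

Lemma arc_of_source n (S : {perm 'I_n}) (a : {a : arc n | a \in Arc S}) :
  arc_of S (source (val a)) = a.
Proof. by apply: val_inj; rewrite /= arc_source // (valP a). Qed.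

Section Coloured.
Variables (n r : nat).
Implicit Types Sigma : coloured_perm n r.

Definition colour Sigma (i : 'I_n) : 'I_r := tagged Sigma (arc_of (tag Sigma) i).

Definition arc_class Sigma u c : pred 'I_n :=
  fun i => ((i <= tag Sigma i) == u) && (colour Sigma i == c).

Lemma coloured_ext Sigma1 Sigma2 :
  tag Sigma1 =1 tag Sigma2 -> colour Sigma1 =1 colour Sigma2 -> Sigma1 = Sigma2.
Proof.
case: Sigma1 Sigma2 => [S1 f1] [S2 f2] /= /permP e; case: S2 / e f2 => f2 ec.
congr (Tagged _ _); apply/ffunP => a; rewrite -(arc_of_source a).
exact: ec.
Qed.

(** Colouring the arcs amounts to colouring the vertices they start from. *)
Lemma coloured_exists (S : {perm 'I_n}) (f : 'I_n -> 'I_r) :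
  exists Sigma : coloured_perm n r, tag Sigma = S /\ colour Sigma =1 f.
Proof.
exists (Tagged (fun S => {ffun {a : arc n | a \in Arc S} -> 'I_r})
  [ffun a : {a : arc n | a \in Arc S} => f (source (val a))]).
by split=> // i; rewrite /colour /= ffunE source_arc.
Qed.

Lemma has_monoP Sigma u P k : has_mono Sigma u P k <->
  exists c s, [/\ size s = k, all (arc_class Sigma u c) s
                & P [seq arc_from (tag Sigma) i | i <- s]].
Proof.
split=> [/existsP[c /existsP[t /and3P[tu tc Pt]]]|[c [s [sz cs Ps]]]].
  exists c, [seq source (val a) | a <- t]; rewrite size_map size_tuple; split=> //.
    apply/allP => _ /mapP[a ta ->]; rewrite /arc_class /colour arc_of_source.
    by rewrite (allP tc _ ta) -upper_arc (arc_source (valP a)) (allP tu _ ta).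
  by rewrite -map_comp (eq_map (g := val)) // => a /=; rewrite arc_source // (valP a).
apply/existsP; exists c; apply/existsP.
have szt : size [seq arc_of (tag Sigma) i | i <- s] == k by rewrite size_map sz.
exists (Tuple szt); rewrite /= !all_map -map_comp; apply/and3P; split=> //.
  by apply: sub_all cs => i /=; rewrite upper_arc => /andP[].
by apply: sub_all cs => i /andP[_] /=.
Qed.

Lemma class_lt Sigma u c i : arc_class Sigma u c i ->
  opos u (tag Sigma i) < cpos u i.
Proof.
by move=> /andP[/eqP e _]; rewrite opos_lt_cpos; case: u e => // /negbT; lia.
Qed.
End Coloured.

(** * Patterns *)

Lemma sorted_map_pairwise (T : Type) (f : T -> nat) s :
  sorted ltn (map f s) = pairwise (fun i j => f i < f j) s.
Proof. by rewrite (sorted_pairwise ltn_trans) pairwise_map. Qed.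

Lemma sorted_rev_pairwise (T : Type) (f : T -> nat) s :
  sorted ltn (rev (map f s)) = pairwise (fun i j => f j < f i) s.
Proof. by rewrite rev_sorted (sorted_pairwise gtn_trans) pairwise_map. Qed.

Lemma sorted_ltn_last (s : seq nat) x : sorted ltn s -> x \in s -> x <= last 0 s.
Proof.
case/lastP: s => // s y; rewrite sorted_rcons last_rcons mem_rcons inE.
by move=> /andP[/allP al _] /orP[/eqP ->//|/al /ltnW].
Qed.

Lemma sorted_ltn_head (s : seq nat) x : sorted ltn s -> x \in s -> head 0 s <= x.
Proof.
case: s => // y s; rewrite sorted_cons inE.
by move=> /andP[/allP al _] /orP[/eqP ->//|/al /ltnW].
Qed.

(** The separation condition of the enhanced patterns, in a form that does not
    depend on the order in which the arcs are listed. *)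
Lemma last_le_head (I J : seq nat) : sorted ltn I -> sorted ltn J ->
  size I = size J ->
  (last 0 I <= head 0 J) <-> {in I & J, forall x y, x <= y}.
Proof.
move=> sI sJ sz; split=> [h x y xI yJ|h].
  apply: leq_trans (sorted_ltn_last sI xI) _.
  exact: leq_trans h (sorted_ltn_head sJ yJ).
case: I J sI sJ sz h => [|a I] [|b J] //= _ _ _ h.
by apply: h; rewrite ?mem_last ?inE ?eqxx.
Qed.

Section Patterns.
Variables (n : nat) (S : {perm 'I_n}) (K : pred 'I_n).

Let arcs s := [seq arc_from S i | i <- s].

Lemma upper_arcs s : (forall i, K i -> i <= S i) -> all K s ->
  [seq left a | a <- arcs s] = [seq val i | i <- s] /\
  [seq right a | a <- arcs s] = [seq val (S i) | i <- s].
Proof.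
move=> hK /allP Ks; rewrite -!map_comp; split; apply/eq_in_map => i /Ks/hK /= h;
by rewrite /arc_from h.
Qed.

Lemma lower_arcs s : (forall i, K i -> S i < i) -> all K s ->
  [seq left a | a <- arcs s] = [seq val (S i) | i <- s] /\
  [seq right a | a <- arcs s] = [seq val i | i <- s].
Proof.
move=> hK /allP Ks; rewrite -!map_comp; split; apply/eq_in_map => i /Ks/hK /= h;
by rewrite /arc_from leqNgt h.
Qed.

Lemma uniq_chain u (s : seq 'I_n) :
  pairwise (fun i j => cpos u j < cpos u i) s -> uniq s.
Proof. by apply: pairwise_uniq => i; rewrite ltnn. Qed.

Lemma pairwise_geq u (s : seq 'I_n) : uniq s ->
  pairwise (fun i j => geq (opos u (S i)) (opos u (S j))) s =
  pairwise (fun i j => opos u (S j) < opos u (S i)) s.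
Proof.
elim: s => //= a s IHs /andP[ans us]; rewrite IHs //; congr (_ && _).
apply: eq_in_all => b bs /=; rewrite leq_eqVlt; case: eqP => //.
by move=> /opos_inj/perm_inj e; rewrite e (negPf ans) in bs *.
Qed.

Lemma enh_crossingP k : (forall i, K i -> i <= S i) ->
  mono_chain geq true K S k <->
  exists s, [/\ size s = k, all K s & enh_crossing (arcs s)].
Proof.
move=> hK; have main s : all K s -> enh_crossing (arcs s) <->
  [/\ pairwise (fun i j => cpos true j < cpos true i) s,
      pairwise (fun i j => geq (opos true (S i)) (opos true (S j))) s
    & {in s &, forall i j, opos true (S i) < cpos true j}].
  move=> Ks; have [eI eJ] := upper_arcs hK Ks; rewrite /enh_crossing eI eJ.
  rewrite !sorted_map_pairwise.
  have e1 : pairwise (fun i j => cpos true j < cpos true i) s =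
      pairwise (fun i j : 'I_n => i < j) s.
    by apply: eq_pairwise => i j; rewrite cpos_lt_mono.
  have e2 : uniq s -> pairwise (fun i j => geq (opos true (S i)) (opos true (S j))) s =
      pairwise (fun i j : 'I_n => S i < S j) s.
    move=> us; rewrite pairwise_geq //.
    by apply: eq_pairwise => i j; rewrite opos_lt_mono.
  have lh := @last_le_head [seq val i | i <- s] [seq val (S i) | i <- s].
  split=> [/and3P[pI pJ h]|[p1 p2 sep]].
    rewrite e1 e2; last by apply: (@uniq_chain true); rewrite e1.
    split=> // i j is_ js; rewrite opos_lt_cpos.
    rewrite -!sorted_map_pairwise in pI pJ.
    by apply: (iffLR (lh pI pJ _) h); rewrite ?size_map //; apply/mapP; [exists j|exists i].
  rewrite -(e2 (uniq_chain p1)) -e1 p1 p2 /=.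
  apply/lh; rewrite ?sorted_map_pairwise -?e1 -?(e2 (uniq_chain p1)) ?size_map //.
  move=> _ _ /mapP[j js ->] /mapP[i is_ ->].
  by have := sep i j is_ js; rewrite opos_lt_cpos.
split=> [[s [sz Ks p1 p2 sep]]|[s [sz Ks /(main s Ks)[p1 p2 sep]]]].
  by exists s; split=> //; apply/main.
by exists s.
Qed.

Lemma enh_nestingP k : (forall i, K i -> i <= S i) ->
  mono_chain ltn true K S k <->
  exists s, [/\ size s = k, all K s & enh_nesting (arcs s)].
Proof.
move=> hK; have main s : all K s -> enh_nesting (arcs s) <->
  [/\ pairwise (fun i j => cpos true j < cpos true i) s,
      pairwise (fun i j => ltn (opos true (S i)) (opos true (S j))) s
    & {in s &, forall i j, opos true (S i) < cpos true j}].
  move=> Ks; have [eI eJ] := upper_arcs hK Ks; rewrite /enh_nesting eI eJ.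
  rewrite sorted_map_pairwise sorted_rev_pairwise.
  have e1 : pairwise (fun i j => cpos true j < cpos true i) s =
      pairwise (fun i j : 'I_n => i < j) s.
    by apply: eq_pairwise => i j; rewrite cpos_lt_mono.
  have e2 : pairwise (fun i j => ltn (opos true (S i)) (opos true (S j))) s =
      pairwise (fun i j : 'I_n => S j < S i) s.
    by apply: eq_pairwise => i j; apply: opos_lt_mono.
  have lh := @last_le_head [seq val i | i <- s] (rev [seq val (S i) | i <- s]).
  rewrite e1 e2; split=> [/and3P[pI pJ h]|[p1 p2 sep]].
    split=> // i j is_ js; rewrite opos_lt_cpos.
    rewrite -sorted_map_pairwise in pI; rewrite -sorted_rev_pairwise in pJ.
    apply: (iffLR (lh pI pJ _) h); rewrite ?size_rev ?size_map ?mem_rev //.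
      by apply/mapP; exists j.
    by apply/mapP; exists i.
  rewrite p1 p2 /=; apply/lh.
  - by rewrite sorted_map_pairwise.
  - by rewrite sorted_rev_pairwise.
  - by rewrite size_rev !size_map.
  move=> _ y /mapP[j js ->]; rewrite mem_rev => /mapP[i is_ ->].
  by have := sep i j is_ js; rewrite opos_lt_cpos.
split=> [[s [sz Ks p1 p2 sep]]|[s [sz Ks /(main s Ks)[p1 p2 sep]]]].
  by exists s; split=> //; apply/main.
by exists s.
Qed.

Lemma nestingP k : (forall i, K i -> S i < i) ->
  mono_chain ltn false K S k <->
  exists s, [/\ size s = k, all K s & nesting (arcs s)].
Proof.
move=> hK; have main s : all K s -> nesting (arcs s) <->
  [/\ pairwise (fun i j => cpos false j < cpos false i) s,
      pairwise (fun i j => ltn (opos false (S i)) (opos false (S j))) s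
    & {in s &, forall i j, opos false (S i) < cpos false j}].
  move=> Ks; have [eI eJ] := lower_arcs hK Ks; rewrite /nesting eI eJ.
  rewrite (sorted_pairwise ltn_trans) pairwise_cat -!(sorted_pairwise ltn_trans).
  rewrite sorted_map_pairwise sorted_rev_pairwise.
  have -> : pairwise (fun i j => cpos false j < cpos false i) s =
      pairwise (fun i j : 'I_n => j < i) s.
    by apply: eq_pairwise => i j; rewrite cpos_lt_mono.
  have -> : pairwise (fun i j => ltn (opos false (S i)) (opos false (S j))) s =
      pairwise (fun i j : 'I_n => S i < S j) s.
    by apply: eq_pairwise => i j; apply: opos_lt_mono.
  split=> [/and3P[/allrelP ar p1 p2]|[p1 p2 sep]].
    split=> // i j is_ js; rewrite opos_lt_cpos; apply: ar.
      by apply/mapP; exists i.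
    by rewrite mem_rev; apply/mapP; exists j.
  rewrite p1 p2 !andbT; apply/allrelP => _ y /mapP[i is_ ->].
  rewrite mem_rev => /mapP[j js ->].
  by have := sep i j is_ js; rewrite opos_lt_cpos.
split=> [[s [sz Ks p1 p2 sep]]|[s [sz Ks /(main s Ks)[p1 p2 sep]]]].
  by exists s; split=> //; apply/main.
by exists s.
Qed.

(** Here [S i < i], so decreasing closers list the arcs from right to left and
    the sequence has to be reversed. *)
Lemma crossingP k : (forall i, K i -> S i < i) ->
  mono_chain geq false K S k <->
  exists s, [/\ size s = k, all K s & crossing (arcs s)].
Proof.
move=> hK; have main s : all K s -> crossing (arcs (rev s)) <->
  [/\ pairwise (fun i j => cpos false j < cpos false i) s,
      pairwise (fun i j => geq (opos false (S i)) (opos false (S j))) s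
    & {in s &, forall i j, opos false (S i) < cpos false j}].
  move=> Ks; have Ksr : all K (rev s) by rewrite all_rev.
  have [eI eJ] := lower_arcs hK Ksr; rewrite /crossing eI eJ.
  rewrite (sorted_pairwise ltn_trans) pairwise_cat -!(sorted_pairwise ltn_trans).
  rewrite !map_rev !sorted_rev_pairwise.
  have e1 : pairwise (fun i j => cpos false j < cpos false i) s =
      pairwise (fun i j : 'I_n => j < i) s.
    by apply: eq_pairwise => i j; rewrite cpos_lt_mono.
  have e2 : uniq s -> pairwise (fun i j => geq (opos false (S i)) (opos false (S j))) s =
      pairwise (fun i j : 'I_n => S j < S i) s.
    move=> us; rewrite pairwise_geq //.
    by apply: eq_pairwise => i j; rewrite opos_lt_mono.
  split=> [/and3P[/allrelP ar p1 p2]|[p1 p2 sep]].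
    rewrite e1 e2; last by apply: (@uniq_chain false); rewrite e1.
    split=> // i j is_ js; rewrite opos_lt_cpos; apply: ar.
      by rewrite mem_rev; apply/mapP; exists i.
    by rewrite mem_rev; apply/mapP; exists j.
  rewrite -(e2 (uniq_chain p1)) -e1 p1 p2 !andbT; apply/allrelP => x y.
  rewrite !mem_rev => /mapP[i is_ ->] /mapP[j js ->].
  by have := sep i j is_ js; rewrite opos_lt_cpos.
split=> [[s [sz Ks p1 p2 sep]]|[s [sz Ks]]].
  by exists (rev s); rewrite size_rev all_rev; split=> //; apply/main.
rewrite -{1}(revK s) => /main[|p1 p2 sep]; first by rewrite all_rev.
by exists (rev s); rewrite size_rev all_rev.
Qed.
End Patterns.

(** * Exchanging crossings and nestings *)

Section Conjugation.
Variables (n r : nat).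
Implicit Types Sigma : coloured_perm n r.

Definition class_events Sigma u c := events u (arc_class Sigma u c) (tag Sigma).

Lemma valid_class_events Sigma u c : valid 0 (class_events Sigma u c).
Proof. by apply: valid_events => i; apply: class_lt. Qed.

Lemma has_crossingP Sigma k : has_crossing Sigma k <->
  exists u c, mono_chain geq u (arc_class Sigma u c) (tag Sigma) k.
Proof.
have up c i : arc_class Sigma true c i -> i <= tag Sigma i by case/andP=> /eqP.
have lo c i : arc_class Sigma false c i -> tag Sigma i < i.
  by case/andP=> /eqP/negbT; rewrite -ltnNge.
split=> [/orP[]/has_monoP[c [s [sz cs Ps]]]|[[] [c]]].
- by exists true, c; apply/(enh_crossingP _ (up c)); exists s.
- by exists false, c; apply/(crossingP _ (lo c)); exists s.
- move/(enh_crossingP _ (up c)) => [s [sz cs Ps]].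
  by apply/orP; left; apply/has_monoP; exists c, s.
move/(crossingP _ (lo c)) => [s [sz cs Ps]].
by apply/orP; right; apply/has_monoP; exists c, s.
Qed.

Lemma has_nestingP Sigma k : has_nesting Sigma k <->
  exists u c, mono_chain ltn u (arc_class Sigma u c) (tag Sigma) k.
Proof.
have up c i : arc_class Sigma true c i -> i <= tag Sigma i by case/andP=> /eqP.
have lo c i : arc_class Sigma false c i -> tag Sigma i < i.
  by case/andP=> /eqP/negbT; rewrite -ltnNge.
split=> [/orP[]/has_monoP[c [s [sz cs Ps]]]|[[] [c]]].
- by exists true, c; apply/(enh_nestingP _ (up c)); exists s.
- by exists false, c; apply/(nestingP _ (lo c)); exists s.
- move/(enh_nestingP _ (up c)) => [s [sz cs Ps]].
  by apply/orP; left; apply/has_monoP; exists c, s.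
move/(nestingP _ (lo c)) => [s [sz cs Ps]].
by apply/orP; right; apply/has_monoP; exists c, s.
Qed.

(** A relation suffices: it is total ([conjugate_exists]) and injective
    ([conjugate_inj]), and so contains the graph of an injection. *)
Definition conjugate Sigma Sigma' := colour Sigma =1 colour Sigma' /\
  forall u c, shapes 0 (class_events Sigma' u c) =
              map conj_part (shapes 0 (class_events Sigma u c)).

Lemma conjugate_chain Sigma Sigma' u c k : conjugate Sigma Sigma' ->
  (mono_chain ltn u (arc_class Sigma' u c) (tag Sigma') k <->
   mono_chain geq u (arc_class Sigma u c) (tag Sigma) k) /\
  (mono_chain geq u (arc_class Sigma' u c) (tag Sigma') k <->
   mono_chain ltn u (arc_class Sigma u c) (tag Sigma) k).
Proof.
move=> [_ /(_ u c) sh].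
have cc p := conj_chain p k (valid_class_events Sigma u c)
                            (valid_class_events Sigma' u c) sh.
split; rewrite !mono_chainP; split=> -[p h]; exists p; move: h; have [] := cc p;
by rewrite /class_events; tauto.
Qed.

Lemma conjugate_crossing Sigma Sigma' k : conjugate Sigma Sigma' ->
  has_crossing Sigma' k -> has_nesting Sigma k.
Proof.
move=> R /has_crossingP[u [c h]]; apply/has_nestingP; exists u, c.
exact/(conjugate_chain u c k R).2.
Qed.

Lemma conjugate_nesting Sigma Sigma' k : conjugate Sigma Sigma' ->
  has_nesting Sigma' k -> has_crossing Sigma k.
Proof.
move=> R /has_nestingP[u [c h]]; apply/has_crossingP; exists u, c.
exact/(conjugate_chain u c k R).1.
Qed.

Lemma conj_part_map_inj : {in all is_part &, injective (map conj_part)}.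
Proof.
move=> L1 L2 p1 p2 /(congr1 (map conj_part)); rewrite -!map_comp.
have idm L : L \in all is_part -> map (conj_part \o conj_part) L = L.
  by move=> /allP pL; apply: map_id_in => l /pL /conj_partK.
by rewrite !idm.
Qed.

Lemma conjugate_inj Sigma1 Sigma2 Sigma' :
  conjugate Sigma1 Sigma' -> conjugate Sigma2 Sigma' -> Sigma1 = Sigma2.
Proof.
move=> [c1 h1] [c2 h2]; apply: coloured_ext => i; last by rewrite c1 c2.
pose u := i <= tag Sigma1 i; pose c := colour Sigma1 i.
have ev : class_events Sigma1 u c = class_events Sigma2 u c.
  have v1 := valid_class_events Sigma1 u c.
  have v2 := valid_class_events Sigma2 u c.
  apply: (shapes_inj v1 v2); rewrite ?tab0 //.
  apply: conj_part_map_inj; rewrite -?h1 -?h2 //; exact: part_shapes.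
have K1 : arc_class Sigma1 u c i by rewrite /arc_class !eqxx.
have := nth_events u (tag Sigma1) K1; rewrite -/(class_events _ _ _) ev.
by move/nth_eventsP => [j [_ /cpos_inj-> /opos_inj]].
Qed.

(** Every class is conjugated separately. The classes keep their openers and
    closers, so the new partners [g i] of the vertices [i] are again distinct
    and form a permutation; each new arc stays on its side because in a valid
    matching openers precede closers, so the classes do not change either. *)
Lemma conjugate_exists Sigma : exists Sigma', conjugate Sigma Sigma'.
Proof.
set S := tag Sigma.
have /fin_all_exists[ev evP] (uc : bool * 'I_r) := conj_events
  (valid_class_events Sigma uc.1 uc.2).
pose cl (i : 'I_n) := (i <= S i, colour Sigma i) : bool * 'I_r.
have clK i : arc_class Sigma (cl i).1 (cl i).2 i by rewrite /arc_class !eqxx.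
have clE uc i : arc_class Sigma uc.1 uc.2 i -> cl i = uc.
  by case: uc => u c /andP[/eqP eu /eqP ec]; rewrite /cl eu ec.
have prof uc : map isSome (class_events Sigma uc.1 uc.2) = map isSome (ev uc) /\
    forall x, (x \in letters (class_events Sigma uc.1 uc.2)) = (x \in letters (ev uc)).
  have [v sh] := evP uc; have v0 := valid_class_events Sigma uc.1 uc.2.
  have [|e1 e2] := conj_profile v0 v _ sh; first by rewrite !tab0.
  by split=> // x; apply: e2.
have isS uc q : isSome (nth None (class_events Sigma uc.1 uc.2) q) =
    isSome (nth None (ev uc) q).
  have [e _] := prof uc; have := congr1 (fun s => nth false s q) e.
  have sz : size (class_events Sigma uc.1 uc.2) = size (ev uc).
    by rewrite -(size_map isSome) e size_map.
  case: (ltnP q (size (ev uc))) => h; first by rewrite !(nth_map None) ?sz.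
  by rewrite !(nth_default None) ?sz.
have /fin_all_exists[g gP] (i : 'I_n) : exists v : 'I_n,
    nth None (ev (cl i)) (cpos (cl i).1 i) = Some (opos (cl i).1 v) /\
    exists2 j, cl j = cl i & v = S j.
  have := isS (cl i) (cpos (cl i).1 i); rewrite /class_events nth_events //.
  case e: nth => [x|] // _.
  have /nth_letters : exists q, nth None (ev (cl i)) q = Some x.
    by exists (cpos (cl i).1 i).
  rewrite -(prof (cl i)).2 => /letters_events[j Kj ->].
  by exists (S j); split=> //; exists j => //; apply: clE.
have g_inj : injective g.
  move=> i1 i2 eg; have [e1 [j1 c1 s1]] := gP i1; have [e2 [j2 c2 s2]] := gP i2.
  have ej : j1 = j2 by apply: (@perm_inj _ S); rewrite -s1 -s2.
  have ec : cl i1 = cl i2 by rewrite -c1 -c2 ej.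
  rewrite eg ec in e1; have [v _] := evP (cl i2).
  exact: cpos_inj (valid_letter_inj v e1 e2).
have [Sigma' [eS ecol]] := coloured_exists (perm g_inj) (colour Sigma).
exists Sigma'; split=> [i|u c]; first by rewrite ecol.
have flag (i : 'I_n) : (i <= g i) = (i <= S i).
  have [e _] := gP i; have [/validP v _] := evP (cl i).
  have [+ _ _] := v _ _ e; rewrite add0n opos_lt_cpos /cl /=.
  by case: (i <= S i) => //; lia.
have [_ <-] := evP (u, c); congr shapes.
have clE' : arc_class Sigma' u c =1 arc_class Sigma u c.
  by move=> i; rewrite /arc_class eS ecol permE flag.
apply: (@eq_from_nth _ None) => [|q].
  have [e _] := prof (u, c); have := congr1 size e; rewrite !size_map => <-.
  by rewrite !size_iota.
rewrite /class_events /events size_mkseq => hq; rewrite nth_mkseq //.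
have := isS (u, c) q; rewrite /class_events /events nth_mkseq //=.
rewrite (_ : closing u (arc_class Sigma' u c) q = closing u (arc_class Sigma u c) q);
  last by apply: eq_pick => i; rewrite clE'.
case e: closing => [i|] /=; last by case: nth.
move=> _; have [Ki <-] := closingP e; have := (gP i).1.
by rewrite (clE (u, c)) //= => ->; rewrite eS permE.
Qed.

End Conjugation.

Lemma conjugation n r : 0 < r -> exists2 F : coloured_perm n r -> coloured_perm n r,
  injective F & forall Sigma, cr (F Sigma) <= ne Sigma /\ ne (F Sigma) <= cr Sigma.
Proof.
move=> r0; have /fin_all_exists[F FP] := @conjugate_exists n r; exists F.
  by move=> S1 S2 e; apply: conjugate_inj (FP S1) _; rewrite e.
move=> Sigma; split.
  have [_ h] := neP Sigma r0; have [h' _] := crP (F Sigma) r0.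
  exact/h/(conjugate_crossing (FP Sigma)).
have [_ h] := crP Sigma r0; have [h' _] := neP (F Sigma) r0.
exact/h/(conjugate_nesting (FP Sigma)).
Qed.

Lemma leq_card_inj (T : finType) (F : T -> T) (P Q : pred T) : injective F ->
  (forall x, P x -> Q (F x)) -> #|[set x | P x]| <= #|[set x | Q x]|.
Proof.
move=> Finj PQ; rewrite -(card_imset _ Finj); apply: subset_leq_card.
by apply/subsetP => _ /imsetP[x + ->]; rewrite !inE; apply: PQ.
Qed.

Theorem corollary1 (j k n r : nat)
  (j_gt0 : 0 < j) (k_gt0 : 0 < k) (n_gt0 : 0 < n) (r_gt0 : 0 < r) :
  NCN j k n r = NCN k j n r /\ NC k n r = NN k n r.
Proof.
have [F Finj FP] := conjugation n r_gt0.
have NCN_le j' k' : NCN j' k' n r <= NCN k' j' n r.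
  apply: (leq_card_inj Finj) => Sigma /andP[hc hn]; have [h1 h2] := FP Sigma.
  by rewrite (leq_ltn_trans h1 hn) (leq_ltn_trans h2 hc).
split; apply/eqP; rewrite eqn_leq; first by rewrite !NCN_le.
apply/andP; split; apply: (leq_card_inj Finj) => Sigma h; have [h1 h2] := FP Sigma.
  exact: leq_ltn_trans h2 h.
exact: leq_ltn_trans h1 h.
Qed.
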